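(* Let $l,T>0$, $\alpha\in(0,1)$, $\mu\in C([0,T])$ with $\mu(t)\ge\mu_0>0$ for all $t\in[0,T]$, and let $\lambda_k=(k\pi/l)^2$, $k\ge1$. For $k\ge1$ let $$\mathcal A_k(t)=1-\int_0^t\frac{1}{\mu(\tau)}\,d\tau-\int_0^t\int_0^\tau R_k(\tau,s)\frac{1}{\mu(s)}\,ds\,d\tau,\qquad t\in[0,T],$$ with the resolvent kernel $R_k$ defined in the context; equivalently, $\mathcal A_k$ is the solution of the homogeneous mode problem $$\partial_t^\alpha\mathcal A_k(t)+\mu(t)\lambda_k\mathcal A_k'(t)+\lambda_k\mathcal A_k(t)=0,\quad t\in(0,T],\qquad \mathcal A_k(0)=1.\qquad( * )$$ Then: (i) $\mathcal A_k\in AC([0,T])$, and for every $\delta\in(0,T)$ one has $\mathcal A_k\in C^1([\delta,T])$ and $\partial_t^\alpha\mathcal A_k\in C([\delta,T])$. In particular, the differential equation in $( * )$ holds pointwise on $[\delta,T]$ for every $\delta\in(0,T)$. (ii) $\mathcal A_k(t)>0$ for all $t\in[0,T]$. Hence $\mathcal A_k(T)>0$ for every $k\ge1$.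
   Context: Caputo derivative: $\partial_t^\alpha v(t)=\frac{1}{\Gamma(1-\alpha)}\int_0^t(t-s)^{-\alpha}v'(s)\,ds$. $AC([0,T])$ denotes absolutely continuous functions on $[0,T]$. For $0\le s<t\le T$ let $$H_k(t,s)=\frac{1}{\mu(t)}+\frac{1}{\mu(t)\lambda_k\Gamma(1-\alpha)}(t-s)^{-\alpha},$$ and let $R_k(t,s)$ be the resolvent kernel (given by the Neumann series) of the Volterra equation $y(t)+\int_0^tH_k(t,s)y(s)\,ds=g(t)$, with the sign convention that its solution is $y(t)=g(t)+\int_0^tR_k(t,s)g(s)\,ds$; that is, $R_k=\sum_{n\ge1}(-1)^nH_k^{(n)}$ with iterated kernels $H_k^{(1)}=H_k$, $H_k^{(n+1)}(t,s)=\int_s^tH_k(t,\sigma)H_k^{(n)}(\sigma,s)\,d\sigma$. *)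

(* Defs.v *)
From HB Require Import structures.
From mathcomp Require Import all_boot all_order all_algebra.
From mathcomp Require Import all_classical all_reals all_analysis.

Set Implicit Arguments.
Unset Strict Implicit.
Unset Printing Implicit Defensive.

Import Order.TTheory GRing.Theory Num.Theory.
Import numFieldNormedType.Exports.

Local Open Scope classical_set_scope.
Local Open Scope ring_scope.

Definition Gamma (R : realType) (x : R) : R :=
  \int[@lebesgue_measure R]_(t in `]0, +oo[) (t `^ (x - 1) * expR (- t)).

Definition abs_cont_on (R : realType) (a b : R) (f : R -> R) : Prop :=
  forall e : R, 0 < e -> exists2 d : R, 0 < d &
    forall (n : nat) (u v : 'I_n -> R),
      (forall i, [/\ a <= u i, u i <= v i & v i <= b]) ->
      trivIset setT (fun i => `]u i, v i[%classic) ->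
      \sum_(i < n) (v i - u i) < d ->
      \sum_(i < n) `|f (v i) - f (u i)| < e.

(* Derivative of the restriction of [f] to [D]: one-sided at the endpoints when
   [D] is a compact interval, so that values of [f] outside [D] play no role. *)
Definition derivable_in (R : realType) (D : set R) (f : R -> R) (x : R) : Prop :=
  cvg ((f y - f x) / (y - x) @[y --> within D x^']).

Definition derive_in (R : realType) (D : set R) (f : R -> R) (x : R) : R :=
  lim ((f y - f x) / (y - x) @[y --> within D x^']).

Definition C1_on (R : realType) (a b : R) (f : R -> R) : Prop :=
  (forall x, x \in `[a, b] -> derivable_in `[a, b] f x) /\
  {within `[a, b], continuous (derive_in `[a, b] f)}.

(* The integrals below are Lebesgue integrals.  The convention [0 `^ (- alpha) = 0]
   and the value of [derive1 v] at the endpoints only matter on null sets. *)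
Definition caputo_ex (R : realType) (alpha : R) (v : R -> R) (t : R) : Prop :=
  (@lebesgue_measure R).-integrable `[0, t]
    (fun s => ((t - s) `^ (- alpha) * derive1 v s)%:E).

Definition caputo (R : realType) (alpha : R) (v : R -> R) (t : R) : R :=
  (Gamma (1 - alpha))^-1 *
  \int[@lebesgue_measure R]_(s in `[0, t]) ((t - s) `^ (- alpha) * derive1 v s).

Definition mode_lambda (R : realType) (l : R) (k : nat) : R :=
  (k%:R * pi / l) ^+ 2.

Definition mode_kernel (R : realType) (alpha : R) (mu : R -> R) (lambda : R)
    (t s : R) : R :=
  (mu t)^-1 +
  (mu t * lambda * Gamma (1 - alpha))^-1 * (t - s) `^ (- alpha).

(* [iterated_kernel H n] is the iterated kernel H^(n+1). *)
Fixpoint iterated_kernel (R : realType) (H : R -> R -> R) (n : nat) (t s : R)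
    {struct n} : R :=
  if n is m.+1 then
    \int[@lebesgue_measure R]_(z in `[s, t]) (H t z * iterated_kernel H m z s)
  else H t s.

Definition resolvent_kernel (R : realType) (H : R -> R -> R) (t s : R) : R :=
  limn (series (fun n => (-1) ^+ n.+1 * iterated_kernel H n t s)).

Definition mode_A (R : realType) (alpha l : R) (mu : R -> R) (k : nat)
    (t : R) : R :=
  let Rk := resolvent_kernel (mode_kernel alpha mu (mode_lambda l k)) in
  1 - \int[@lebesgue_measure R]_(tau in `[0, t]) (mu tau)^-1
    - \int[@lebesgue_measure R]_(tau in `[0, t])
        \int[@lebesgue_measure R]_(s in `[0, tau]) (Rk tau s * (mu s)^-1).

Definition mode_equation_at (R : realType) (alpha T : R) (mu : R -> R)
    (lambda : R) (w : R -> R) (t : R) : Prop :=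
  caputo alpha w t + mu t * lambda * derive_in `[0, T] w t + lambda * w t = 0.

(* Classical solutions: absolutely continuous on [0, T], continuously
   differentiable away from 0. *)
Definition mode_solution (R : realType) (alpha T : R) (mu : R -> R)
    (lambda : R) (w : R -> R) : Prop :=
  [/\ abs_cont_on 0 T w,
      forall delta, delta \in `]0, T[ -> C1_on delta T w,
      forall t, t \in `]0, T] ->
        caputo_ex alpha w t /\ mode_equation_at alpha T mu lambda w t
    & w 0 = 1].

(* Main.v *)
Require Import Defs.
From HB Require Import structures.
From mathcomp Require Import all_boot all_order all_algebra.
From mathcomp Require Import all_classical all_reals all_analysis.
From mathcomp Require Import measurable_realfun ring lra.

Set Implicit Arguments.
Unset Strict Implicit.
Unset Printing Implicit Defensive.

Import Order.TTheory GRing.Theory Num.Theory.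
Import numFieldNormedType.Exports.

Local Open Scope classical_set_scope.
Local Open Scope ring_scope.

(** Taking the derivative as the unknown turns the mode problem into a Volterra
    equation of the second kind. With [Y] the derivative of a solution that
    starts at 1, the equation reads [Y + V Y = - 1 / mu], where [V] is the
    integral operator of the kernel [mode_kernel]. The singularity
    [(t - s) `^ (- alpha)] of the kernel is integrable, so [V] sends bounded
    measurable functions to continuous ones ([fractional_integral_continuous]); hence [Y] is continuous
    on the whole of [0, T], the singular point 0 included, and the solution is
    even C^1 there. Everything in (i) follows from this.

    That the resolvent kernel does produce this [Y] rests on two facts about the
    iterated kernels. First, they are bounded by
    [B * 2^-1 ^+ n * (t - s) `^ (- alpha)] ([iterated_kernel_le]): for a large
    rate [sg], multiplying the kernel by [expR (- sg * (t - s))] makes the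
    composition with it contract the weight [(t - s) `^ (- alpha)] by a factor
    of a half ([exists_contracting_weight]), and the exponential is bounded on a
    bounded interval. So no Beta integral is needed, and the Neumann series
    converges geometrically. Second, by Tonelli, integrating the iterated
    kernels against [1 / mu] amounts to iterating [V] ([neumann_termS]). Summing
    up, [S], the integral of the resolvent kernel against [1 / mu], satisfies
    [S = - (V (1 / mu) + V S)] ([resolvent_integral_eq]), which is the Volterra
    equation for [Y = - (1 / mu + S)].

    Positivity and uniqueness both come from an extremum principle. If [v]
    attains its minimum over [0, t] at the right end [t], then integrating by
    parts against the increasing kernel [(t - s) `^ (- alpha)] gives
    [\int (t - s) `^ (- alpha) * v'(s) <= - t `^ (- alpha) * (v 0 - v t)]
    ([caputo_integral_at_min]). At a minimum over [0, T] that lies below [v 0]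
    the Caputo term is therefore negative and the first derivative is at most 0,
    so the equation forces [v] to be positive there
    ([mode_data_comparison]). Applied to a solution with [v 0 = 1] this is (ii);
    applied to the differences of two solutions, in both orders, it is
    uniqueness. Uniqueness in turn identifies every solution with the function
    given by the resolvent. *)

Local Notation leb := (@lebesgue_measure _).

(** * Power functions with an integrable singularity *)

(** The antiderivative is continuous up to the end points although the integrand
    may blow up there: exhaust the open interval by compact ones and pass to the
    limit by monotone convergence. *)
Lemma ge0_FTC2_oo {R : realType} (f F : R -> R) (a b : R) : a < b ->
  {in `]a, b[, continuous f} -> (forall x, x \in `]a, b[ -> 0 <= f x) ->
  {within `[a, b], continuous F} ->
  (forall x, x \in `]a, b[ -> is_derive x 1 F (f x)) ->
  (\int[@lebesgue_measure R]_(x in `[a, b]) (f x)%:E = (F b - F a)%:E)%E.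
Proof.
move=> ab cf f0 cF dF.
(* The denominator is at least 3, so that a + e n stays below b - e n. *)
pose e (n : nat) : R := (b - a) / n.+3%:R.
have e0 n : 0 < e n by rewrite divr_gt0 ?subr_gt0// ltr0n.
have e2 n : a + e n < b - e n.
  rewrite -subr_gt0.
  have : e n * 3 <= b - a.
    rewrite /e mulrAC ler_pdivrMr ?ltr0n// ler_wpM2l ?subr_ge0 ?(ltW ab)//.
    by rewrite ler_nat.
  by have := e0 n; lra.
have sub n x : x \in `[a + e n, b - e n] -> x \in `]a, b[.
  by rewrite !in_itv/= => /andP[h1 h2]; have := e0 n; lra.
have mf : measurable_fun `]a, b[ f.
  by apply: open_continuous_measurable_fun => // x /= xab; apply: cf; rewrite -inE.
have cF' : {in `]a, b[, continuous F}.
  by move: cF => /(continuous_within_itvP _ ab)[].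
pose I n : set R := `[a + e n, b - e n]%classic.
have intn n : (\int[@lebesgue_measure R]_(x in I n) (f x)%:E =
    (F (b - e n)%R - F (a + e n)%R)%R%:E)%E.
  rewrite (@continuous_FTC2 R f F) ?EFinB//.
  - apply: continuous_in_subspaceT => x; rewrite inE/= => /sub; exact: cf.
  - split=> [x xn||].
    + have xab : x \in `]a, b[ by apply: (sub n); exact: subset_itv_oo_cc.
      by apply: ex_derive; exact: dF.
    + apply: cvg_at_right_filter; apply: cF'; apply: (sub n).
      by rewrite in_itv/= lexx (ltW (e2 n)).
    + apply: cvg_at_left_filter; apply: cF'; apply: (sub n).
      by rewrite in_itv/= lexx (ltW (e2 n)).
  - move=> x xn.
    have xab : x \in `]a, b[ by apply: (sub n); exact: subset_itv_oo_cc.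
    by rewrite derive1E; have [_ ->] := dF _ xab.
have ecvg : e n @[n --> \oo] --> 0.
  rewrite /e -(mulr0 (b - a)); apply: cvgM; first exact: cvg_cst.
  have := @cvg_harmonic R; rewrite -(cvg_shiftn 2); apply: cvg_trans.
  by apply: near_eq_cvg; near=> n; rewrite /harmonic/= addn2.
have bigcupE : \bigcup_n I n = `]a, b[%classic.
  apply/seteqP; split=> [x [n _] /= xn|x /= xab]; first exact: (sub n).
  move: xab; rewrite in_itv/= => /andP[ax xb].
  have /cvgr_lt /(_ (Num.min (x - a) (b - x))) : e n @[n --> \oo] --> 0 by [].
  case; first by rewrite lt_min !subr_gt0 ax.
  move=> N _ /(_ N (leqnn N)) /=; rewrite lt_min => /andP[h1 h2].
  by exists N => //; rewrite /I/= in_itv/=; lra.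
have nd : nondecreasing_seq I.
  move=> m n mn; rewrite subsetEset => x; rewrite /I/= !in_itv/= => /andP[h1 h2].
  have : e n <= e m.
    rewrite /e ler_wpM2l ?subr_ge0 ?(ltW ab)// lef_pV2 ?posrE ?ltr0n//.
    by rewrite ler_nat.
  by lra.
have : (\int[@lebesgue_measure R]_(x in I n) (f x)%:E
    @[n --> \oo] --> \int[@lebesgue_measure R]_(x in `]a, b[) (f x)%:E)%E.
  rewrite -bigcupE; apply: ge0_nondecreasing_set_cvg_integral => //.
  - by move=> n; exact: measurable_itv.
  - move=> n; apply/measurable_EFinP; apply: measurable_funS mf => //.
    by move=> x; exact: sub.
  - by move=> n x /= /sub xab; rewrite lee_fin f0.
under eq_fun do rewrite intn.
have Fcvg : (F (b - e n) - F (a + e n))%:E @[n --> \oo] --> (F b - F a)%:E.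
  apply: cvg_EFin; first exact: nearW.
  have [_ Fa Fb] := (continuous_within_itvP _ ab).1 cF.
  apply: cvgB.
  - move/cvg_at_leftP : Fb; apply; split; first by move=> n; rewrite ltrBlDr ltrDl.
    by rewrite -[X in _ --> X]subr0; apply: cvgB => //; exact: cvg_cst.
  - move/cvg_at_rightP : Fa; apply; split; first by move=> n; rewrite ltrDl.
    by rewrite -[X in _ --> X]addr0; apply: cvgD => //; exact: cvg_cst.
move=> /(cvg_unique _ Fcvg) -> //.
rewrite integral_itv_bndoo//.
exact/measurable_EFinP.
Unshelve. all: by end_near. Qed.

Lemma is_derive1_continuous {R : realType} (f : R -> R) (x d : R) :
  is_derive x 1 f d -> {for x, continuous f}.
Proof. by case=> /derivable1_diffP/differentiable_continuous. Qed.

Lemma is_derive1_powR_comp {R : realType} (u : R -> R) (x du p : R) :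
  is_derive x 1 u du -> 0 < u x ->
  is_derive x 1 (fun s => u s `^ p) (p * u x `^ (p - 1) * du).
Proof.
move=> hu u0.
exact: (@is_derive1_comp R (@powR R ^~ p) u x _ du (is_derive1_powR p u0) hu).
Qed.

(** [powR] is constant 1 on negative numbers, hence discontinuous at 0; cutting
    off the negative part gives an everywhere continuous extension of the power
    function from the half line. *)
Lemma continuous_powR_max0 {R : realType} (p : R) : 0 < p ->
  continuous (fun x : R => (Num.max 0 x) `^ p).
Proof.
move=> p0 x; have [x0|x0|x0] := ltgtP x 0.
- rewrite /prop_for/continuous_at max_l ?(ltW x0)//.
  have : (fun _ : R => 0 `^ p) z @[z --> x] --> 0 `^ p by exact: cvg_cst.
  apply: cvg_trans; apply: near_eq_cvg; near=> y; rewrite max_l//.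
  by apply: ltW; near: y; exact: lt_nbhsl.
- have := is_derive1_continuous (is_derive1_powR p x0).
  rewrite /prop_for/continuous_at max_r ?(ltW x0)//; apply: cvg_trans.
  apply: near_eq_cvg; near=> y; rewrite max_r//.
  by apply: ltW; near: y; exact: lt_nbhsr.
- rewrite x0 /prop_for/continuous_at maxxx powR0 ?gt_eqF//.
  apply/cvgrPdist_lt => e e0; near=> y.
  rewrite sub0r normrN ger0_norm ?powR_ge0//.
  have -> : e = (e `^ p^-1) `^ p by rewrite -powRrM mulVf ?gt_eqF// powRr1// ltW.
  apply: gt0_ltr_powR => //; rewrite ?nnegrE ?powR_ge0// ?le_max ?lexx//.
  rewrite gt_max powR_gt0//=.
  by near: y; apply: lt_nbhsl; rewrite powR_gt0.
Unshelve. all: by end_near. Qed.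

Lemma integral_powR_lsing {R : realType} (g a b : R) : g < 1 -> a <= b ->
  (\int[leb]_(s in `[a, b]) ((s - a) `^ (- g))%:E =
   ((b - a) `^ (1 - g) / (1 - g))%:E)%E.
Proof.
move=> g1; have g1' : 0 < 1 - g by rewrite subr_gt0.
rewrite le_eqVlt => /predU1P[<-|ab].
  by rewrite set_itv1 integral_set1 subrr powR0 ?gt_eqF// mul0r.
pose F s : R := (Num.max 0 (s - a)) `^ (1 - g) / (1 - g).
have -> : (b - a) `^ (1 - g) / (1 - g) = F b - F a.
  rewrite /F subrr maxxx powR0 ?gt_eqF// mul0r subr0 max_r//.
  by rewrite subr_ge0 ltW.
have ca (x : R) : is_derive x 1 (fun s : R => s - a) (1 : R).
  by apply: is_derive_eq; rewrite subr0.
apply: ge0_FTC2_oo => //.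
- move=> x; rewrite in_itv/= => /andP[ax xb].
  apply: is_derive1_continuous; apply: is_derive1_powR_comp.
  by rewrite subr_gt0.
- by move=> x _; exact: powR_ge0.
- apply: continuous_subspaceT => x; apply: cvgM; last exact: cvg_cst.
  apply: (@continuous_comp _ _ _ (fun s => s - a)
    (fun x => (Num.max 0 x) `^ (1 - g))); last exact: continuous_powR_max0.
  exact: is_derive1_continuous.
- move=> x; rewrite in_itv/= => /andP[ax xb].
  apply: (@near_eq_is_derive _ _ _
    (fun s => (1 - g)^-1 * (s - a) `^ (1 - g))).
    near=> s; rewrite /F mulrC max_r// subr_ge0 ltW//.
    by near: s; exact: lt_nbhsr.
  have xa : 0 < x - a by rewrite subr_gt0.
  have := @is_deriveZ _ _ _ _ (1 - g)^-1 _ _ _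
    (is_derive1_powR_comp (1 - g) (ca x) xa).
  move/is_derive_eq; apply.
  by rewrite /GRing.scale/= mulr1 mulKf ?gt_eqF//; congr (_ `^ _); lra.
Unshelve. all: by end_near. Qed.

Lemma integral_powR_rsing {R : realType} (g a b : R) : g < 1 -> a <= b ->
  (\int[leb]_(s in `[a, b]) ((b - s) `^ (- g))%:E =
   ((b - a) `^ (1 - g) / (1 - g))%:E)%E.
Proof.
move=> g1; have g1' : 0 < 1 - g by rewrite subr_gt0.
rewrite le_eqVlt => /predU1P[<-|ab].
  by rewrite set_itv1 integral_set1 subrr powR0 ?gt_eqF// mul0r.
pose F s : R := - ((Num.max 0 (b - s)) `^ (1 - g) / (1 - g)).
have -> : (b - a) `^ (1 - g) / (1 - g) = F b - F a.
  rewrite /F subrr maxxx powR0 ?gt_eqF// mul0r oppr0 sub0r opprK max_r//.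
  by rewrite subr_ge0 ltW.
have ca (x : R) : is_derive x 1 (fun s : R => b - s) (-1 : R).
  by apply: is_derive_eq; rewrite add0r mul1r.
apply: ge0_FTC2_oo => //.
- move=> x; rewrite in_itv/= => /andP[ax xb].
  apply: is_derive1_continuous; apply: is_derive1_powR_comp.
  by rewrite subr_gt0.
- by move=> x _; exact: powR_ge0.
- apply: continuous_subspaceT => x; apply: cvgN.
  apply: cvgM; last exact: cvg_cst.
  apply: (@continuous_comp _ _ _ (fun s => b - s)
    (fun x => (Num.max 0 x) `^ (1 - g))); last exact: continuous_powR_max0.
  exact: is_derive1_continuous.
- move=> x; rewrite in_itv/= => /andP[ax xb].
  apply: (@near_eq_is_derive _ _ _
    (fun s => (- (1 - g)^-1) * (b - s) `^ (1 - g))).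
    near=> s; rewrite /F mulNr mulrC max_r// subr_ge0 ltW//.
    by near: s; exact: lt_nbhsl.
  have xa : 0 < b - x by rewrite subr_gt0.
  have := @is_deriveZ _ _ _ _ (- (1 - g)^-1) _ _ _
    (is_derive1_powR_comp (1 - g) (ca x) xa).
  move/is_derive_eq; apply.
  by rewrite /GRing.scale/= mulrN1 mulrNN mulKf ?gt_eqF//; congr (_ `^ _); lra.
Unshelve. all: by end_near. Qed.

Lemma measurable_powR_subr {R : realType} (p a : R) (D : set R) :
  measurable_fun D (fun s : R => (s - a) `^ p).
Proof.
apply: measurable_funTS.
by apply: (measurableT_comp (measurable_powR p)); exact: measurable_funB.
Qed.

Lemma measurable_powR_subl {R : realType} (p a : R) (D : set R) :
  measurable_fun D (fun s : R => (a - s) `^ p).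
Proof.
apply: measurable_funTS.
by apply: (measurableT_comp (measurable_powR p)); exact: measurable_funB.
Qed.

Lemma ge0_integrable_fin {R : realType} (D : set R) (f : R -> R) (r : R) :
  measurable D -> measurable_fun D f -> (forall x, D x -> 0 <= f x) ->
  (\int[leb]_(x in D) (f x)%:E <= r%:E)%E -> leb.-integrable D (EFin \o f).
Proof.
move=> mD mf f0 fr; apply/integrableP; split; first exact/measurable_EFinP.
apply: (@le_lt_trans _ _ r%:E); last exact: ltry.
apply: le_trans fr; rewrite le_eqVlt; apply/orP; left; apply/eqP.
by apply: eq_integral => x /[!inE] Dx; rewrite /= ger0_norm ?f0.
Qed.

Lemma integrable_powR_rsing {R : realType} (g a b : R) : g < 1 ->
  leb.-integrable `[a, b] (EFin \o (fun s => (b - s) `^ (- g))).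
Proof.
move=> g1; have [ab|ba] := leP a b; last first.
  by rewrite set_itv_ge ?bnd_simp -?ltNge//; exact: integrable_set0.
apply: (ge0_integrable_fin (r := (b - a) `^ (1 - g) / (1 - g))) => //.
- exact: measurable_powR_subl.
- by move=> x _; exact: powR_ge0.
- by rewrite integral_powR_rsing.
Qed.

(** * The Gamma function on ]0, 1[ *)

Lemma is_derive1_expRN {R : realType} (x : R) :
  is_derive x 1 (fun t : R => expR (- t)) (- expR (- x)).
Proof. by apply: is_derive_eq; rewrite mulrN1. Qed.

Lemma measurable_expRN {R : realType} : measurable_fun setT (fun t : R => expR (- t)).
Proof.
apply: continuous_measurable_fun => x.
exact: is_derive1_continuous (is_derive1_expRN x).
Qed.

(** The integrand is below [t `^ (- alpha)] near 0 and below [expR (- t)] near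
    infinity. *)
Lemma Gamma_integrand_integral_lty {R : realType} (alpha : R) :
  0 < alpha < 1 ->
  (\int[leb]_(t in `]0%R, +oo[) (t `^ (- alpha) * expR (- t))%:E < +oo)%E.
Proof.
move=> /andP[a0 a1].
pose f (t : R) := t `^ (- alpha) * expR (- t).
have f0 t : 0 <= f t by rewrite mulr_ge0 ?powR_ge0 ?expR_ge0.
have me := @measurable_expRN R.
have mf : measurable_fun setT f by exact: measurable_funM.
have -> : `]0%R, +oo[%classic = `]0%R, 1%R] `|` `]1%R, +oo[ :> set R.
  by apply/seteqP; split=> x /=; rewrite !in_itv/= !andbT; lra.
rewrite ge0_integral_setU//=; last 3 first.
- by apply/measurable_EFinP; exact: measurable_funTS.
- by move=> x _; rewrite lee_fin f0.
- by rewrite disj_set2E; apply/eqP/seteqP; split=> // x [] /=; rewrite !in_itv/= andbT; lra.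
apply: lte_add_pinfty.
  apply: (@le_lt_trans _ _ (\int[leb]_(t in `]0%R, 1%R]) (t `^ (- alpha))%:E)%E).
    apply: ge0_le_integral => //=.
    - by move=> x _; rewrite lee_fin f0.
    - by apply/measurable_EFinP; exact: measurable_funTS.
    - by apply/measurable_EFinP; exact: measurable_funTS.
    move=> x; rewrite in_itv/= => /andP[x0 _].
    by rewrite lee_fin ler_piMr ?powR_ge0// -expR0 ler_expR oppr_le0 ltW.
  rewrite integral_itv_obnd_cbnd; last first.
    by apply/measurable_EFinP; exact: measurable_funTS.
  have := @integral_powR_lsing R alpha 0 1 a1 ler01.
  under eq_integral do rewrite subr0.
  by move=> ->; rewrite ltry.
apply: (@le_lt_trans _ _ (\int[leb]_(t in `]1%R, +oo[) (expR (- t))%:E)%E).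
  apply: ge0_le_integral => //=.
  - by move=> x _; rewrite lee_fin f0.
  - by apply/measurable_EFinP; exact: measurable_funTS.
  - by apply/measurable_EFinP; exact: measurable_funTS.
  move=> x; rewrite in_itv/= andbT => x1.
  rewrite lee_fin ler_piMl ?expR_ge0// -(@powRr0 R x) ler_powR ?(ltW x1)//.
  by rewrite oppr_le0 ltW.
rewrite integral_itv_obnd_cbnd; last first.
  by apply/measurable_EFinP; exact: measurable_funTS.
have de (x : R) : is_derive x 1 (fun t : R => - expR (- t)) (expR (- x)).
  by have := is_deriveN (is_derive1_expRN x); rewrite opprK.
rewrite (@ge0_continuous_FTC2y R _ (fun t : R => - expR (- t)) 1 0) ?ltry//.
- apply: continuous_subspaceT => x; exact: is_derive1_continuous (is_derive1_expRN x).
- rewrite -oppr0; apply: cvgN.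
  exact: cvgr_expR.
- by apply: cvg_at_right_filter; exact: (is_derive1_continuous (de 1)).
- by move=> x _; rewrite derive1E; case: (de x).
Qed.

(** Finiteness matters here: the real-valued integral of a function with
    infinite integral is 0. The lower bound comes from the interval [1, 2]. *)
Lemma Gamma_gt0 {R : realType} (alpha : R) : 0 < alpha < 1 ->
  0 < Gamma (1 - alpha).
Proof.
move=> a01; have lty := Gamma_integrand_integral_lty a01.
rewrite /Gamma (_ : 1 - alpha - 1 = - alpha); last by lra.
case/andP: a01 => a0 a1.
pose f (t : R) := t `^ (- alpha) * expR (- t).
have f0 t : 0 <= f t by rewrite mulr_ge0 ?powR_ge0 ?expR_ge0.
have me := @measurable_expRN R.
have mf : measurable_fun setT f by exact: measurable_funM.
rewrite /Rintegral fine_gt0// lty andbT.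
apply: (@lt_le_trans _ _ (\int[leb]_(t in `[1%R, 2%R]) (2^-1 * expR (- 2))%:E)%E).
  rewrite integral_cst//= lebesgue_measure_itv/= lte_fin ltr1n -EFinB -EFinM lte_fin.
  by rewrite mulr_gt0 ?mulr_gt0 ?invr_gt0 ?expR_gt0// subr_gt0 ltr1n.
apply: (@le_trans _ _ (\int[leb]_(t in `[1%R, 2%R]) (f t)%:E)%E).
  apply: ge0_le_integral => //=.
  - by apply/measurable_EFinP; exact: measurable_funTS.
  move=> x; rewrite in_itv/= => /andP[x1 x2]; rewrite lee_fin /f.
  apply: ler_pM; rewrite ?invr_ge0 ?expR_ge0//; last by rewrite ler_expR lerN2.
  apply: (@le_trans _ _ (x `^ (- 1))).
    by rewrite powR_inv1 ?lef_pV2 ?posrE//; lra.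
  by rewrite ler_powR// lerN2 ltW.
apply: ge0_subset_integral => //=.
- by apply/measurable_EFinP; exact: measurable_funTS.
- by move=> x _; rewrite lee_fin f0.
- by move=> x /=; rewrite !in_itv/= andbT; lra.
Qed.

(** * The extremum principle for the Caputo derivative *)

(** With [F x = (t - x) `^ (- alpha) * (v x - v t)], the function
    [F x - \int_0^x (t - s) `^ (- alpha) * d s] has derivative
    [alpha * (t - x) `^ (- alpha - 1) * (v x - v t)], which is nonnegative since
    [v t] is the minimum. Comparing its values at 0 and [t] is an integration by
    parts in which the singular boundary term vanishes, because [v x - v t] is
    of order [t - x]. *)
Lemma caputo_integral_at_min {R : realType} (alpha t l : R) (v d : R -> R) :
  0 < alpha < 1 -> 0 < t ->
  {within `[0, t], continuous v} ->
  (forall s, s \in `]0, t[ -> is_derive s 1 v (d s)) ->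
  (forall s, s \in `]0, t[ -> {for s, continuous d}) ->
  (v s - v t) / (s - t) @[s --> t^'-] --> l ->
  leb.-integrable `[0, t] (EFin \o (fun s => (t - s) `^ (- alpha) * d s)) ->
  (forall s, s \in `[0, t] -> v t <= v s) ->
  \int[leb]_(s in `[0, t]) ((t - s) `^ (- alpha) * d s) <=
    - (t `^ (- alpha) * (v 0 - v t)).
Proof.
move=> /andP[a0 a1] t0 cv dv cd ql ip vmin.
pose p s := (t - s) `^ (- alpha) * d s.
pose P x := \int[leb]_(s in `[0, x]) p s.
pose F x := (t - x) `^ (- alpha) * (v x - v t).
have [cv_in cv0 cvt] := (continuous_within_itvP _ t0).1 cv.
have dk (x : R) : x < t ->
    is_derive x 1 (fun s : R => (t - s) `^ (- alpha))
      (alpha * (t - x) `^ (- alpha - 1)).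
  move=> xt; have ut : is_derive x 1 (fun s : R => t - s) (-1 : R).
    by apply: is_derive_eq; rewrite add0r mul1r.
  have xt0 : 0 < t - x by rewrite subr_gt0.
  apply: is_derive_eq (is_derive1_powR_comp (- alpha) ut xt0) _.
  by rewrite mulrN1 mulNr opprK.
have dF x : x \in `]0, t[ -> is_derive x 1 F
    (p x + alpha * (t - x) `^ (- alpha - 1) * (v x - v t)).
  move=> xt; have xt' : x < t by move: xt; rewrite in_itv/= => /andP[].
  have h1 : is_derive x 1 (fun s => v s - v t) (d x).
    apply: is_derive_eq (is_deriveB (dv _ xt) (is_derive_cst _ _ _)) _.
    by rewrite subr0.
  apply: is_derive_eq (is_deriveM (dk _ xt') h1) _.
  by rewrite /p /GRing.scale/=; ring.
have dP x : x \in `]0, t[ -> is_derive x 1 P (p x).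
  move=> xt; have /andP[x0 xt'] : 0 < x < t by move: xt; rewrite in_itv.
  have cp : {for x, continuous p}.
    by apply: cvgM; [exact: (is_derive1_continuous (dk _ xt'))|exact: cd].
  have [h1 h2] := continuous_FTC1_closed xt' ip x0 cp.
  by split; [exact: h1|rewrite -derive1E].
have dG x : x \in `]0, t[ -> is_derive x 1 (fun s => F s - P s)
    (alpha * (t - x) `^ (- alpha - 1) * (v x - v t)).
  move=> xt; apply: is_derive_eq (is_deriveB (dF _ xt) (dP _ xt)) _.
  by rewrite addrAC subrr add0r.
have cP : {within `[0, t], continuous P}.
  exact: parameterized_integral_continuous (ltW t0) ip.
have Ft : F t = 0 by rewrite /F (subrr (v t)) mulr0.
have cF : {within `[0, t], continuous F}.
  apply/(continuous_within_itvP _ t0); split.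
  - by move=> x xt; exact: is_derive1_continuous (dF _ xt).
  - apply: cvgM; last by apply: cvgB => //; exact: cvg_cst.
    by apply: cvg_at_right_filter; exact: (is_derive1_continuous (dk _ t0)).
  - rewrite Ft.
    (* F s is - (t - s) `^ (1 - alpha) times a convergent difference quotient. *)
    have h1 : - ((Num.max 0 (t - s)) `^ (1 - alpha)) @[s --> t^'-] --> 0.
      apply: cvg_at_left_filter; rewrite -[X in _ --> X]oppr0; apply: cvgN.
      have a1' : 0 < 1 - alpha by rewrite subr_gt0.
      have E0 : (Num.max 0 (t - t)) `^ (1 - alpha) = 0.
        by rewrite subrr maxxx powR0// gt_eqF.
      rewrite -[X in _ --> X]E0.
      apply: (@continuous_cvg _ _ _ _ _ (fun s => t - s)
        (fun x => (Num.max 0 x) `^ (1 - alpha))).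
        exact: continuous_powR_max0.
      by apply: cvgB; [exact: cvg_cst|exact: cvg_id].
    have /(_ (at_left_proper_filter t)) h2 := cvgM h1 ql; rewrite mul0r in h2.
    apply: cvg_trans h2.
    apply: near_eq_cvg; apply: filterS (nbhs_left_lt t) => s st.
    have ts0 : 0 < t - s by rewrite subr_gt0.
    rewrite /F/= max_r ?(ltW ts0)// powRD; last by rewrite (gt_eqF ts0) implybT.
    rewrite powRr1 ?(ltW ts0)//.
    by field; rewrite subr_eq0 lt_eqF.
have cG : {within `[0, t], continuous (fun s => F s - P s)}.
  by move=> x; apply: cvgB; [exact: cF|exact: cP].
have hG : F 0 - P 0 <= F t - P t.
  apply: (ger0_derive1_le_cc (f := fun s => F s - P s) _ _ cG);
    rewrite ?in_itv/= ?lexx ?(ltW t0)//.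
  - by move=> x xt; case: (dG _ xt).
  - move=> x xt; rewrite derive1E; have [_ ->] := dG _ xt.
    rewrite mulr_ge0 ?mulr_ge0 ?powR_ge0 ?(ltW a0)// subr_ge0 vmin//.
    exact: subset_itv_oo_cc.
have P0 : P 0 = 0 by rewrite /P set_itv1 Rintegral_set1.
by move: hG; rewrite P0 Ft /F !subr0 sub0r -/(P t) lerNr.
Unshelve. all: by end_near. Qed.

(** The data that the comparison argument uses, in a form that is stable under
    differences: [d] is the derivative in the open interval, and [e] the left
    derivative, which also makes sense at the right end. *)
Record mode_data {R : realType} (alpha c T : R) (m : R -> R) (lambda : R)
    (v d e : R -> R) : Prop := ModeData {
  md_cont : {within `[0, T], continuous v};
  md_derive : forall t, t \in `]0, T[ -> is_derive t 1 v (d t);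
  md_derive_cont : forall t, t \in `]0, T[ -> {for t, continuous d};
  md_left : forall t, t \in `]0, T] ->
    (v s - v t) / (s - t) @[s --> t^'-] --> e t;
  md_int : forall t, t \in `]0, T] ->
    leb.-integrable `[0, t] (EFin \o (fun s => (t - s) `^ (- alpha) * d s));
  md_eq : forall t, t \in `]0, T] ->
    c * (\int[leb]_(s in `[0, t]) ((t - s) `^ (- alpha) * d s))
      + m t * e t + lambda * v t = 0 }.

Lemma mode_dataB {R : realType} (alpha c T : R) m lambda
    (v1 d1 e1 v2 d2 e2 : R -> R) :
  mode_data alpha c T m lambda v1 d1 e1 ->
  mode_data alpha c T m lambda v2 d2 e2 ->
  mode_data alpha c T m lambda (fun s => v1 s - v2 s) (fun s => d1 s - d2 s)
    (fun s => e1 s - e2 s).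
Proof.
case=> c1 h1 k1 l1 i1 q1 [c2 h2 k2 l2 i2 q2]; split.
- by move=> x; apply: cvgB; [exact: c1|exact: c2].
- by move=> t tT; exact: is_deriveB (h1 _ tT) (h2 _ tT).
- by move=> t tT; apply: cvgB; [exact: k1|exact: k2].
- move=> t tT; have /(_ (at_left_proper_filter t)) := cvgB (l1 _ tT) (l2 _ tT).
  apply: cvg_trans.
  by apply: near_eq_cvg; near=> s; rewrite /= -mulrBl !opprD !opprK addrACA.
- move=> t tT.
  have mI : @measurable _ (measurableTypeR R) `[0, t] by exact: measurable_itv.
  have := integrableB mI (i1 _ tT) (i2 _ tT).
  by apply: eq_integrable => // s _; rewrite /= -EFinB mulrBr.
- move=> t tT; under eq_Rintegral do rewrite mulrBr.
  rewrite RintegralB//; [|exact: i1|exact: i2].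
  have := q1 _ tT; have := q2 _ tT; lra.
Unshelve. all: by end_near. Qed.

(** At a point of minimum the left derivative is at most 0 and the Caputo term is
    negative if the value is below [v 0], so the zeroth order term of the
    equation has to be positive. *)
Lemma mode_data_comparison {R : realType} (alpha c T : R) m lambda
    (v d e : R -> R) :
  0 < alpha < 1 -> 0 < c -> 0 < T -> 0 < lambda ->
  (forall t, t \in `[0, T] -> 0 < m t) ->
  mode_data alpha c T m lambda v d e -> 0 <= v 0 ->
  forall t, t \in `[0, T] -> 0 <= v t /\ (0 < v 0 -> 0 < v t).
Proof.
move=> a01 c0 T0 l0 m0 [cv dv cd ql ip eqv] v0.
have [t0 t0T tmin] := EVT_min (ltW T0) cv.
suff h : 0 <= v t0 /\ (0 < v 0 -> 0 < v t0).
  move=> t tT; case: h => h1 h2; split; first exact: le_trans h1 (tmin _ tT).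
  by move=> /h2 h; exact: lt_le_trans h (tmin _ tT).
have key : v t0 < v 0 -> 0 < v t0.
  move=> vlt.
  have t00 : 0 < t0.
    rewrite lt_neqAle; move: t0T; rewrite in_itv/= => /andP[-> _]; rewrite andbT.
    by apply/eqP => t00; rewrite -t00 ltxx in vlt.
  have t0T' : t0 <= T by move: t0T; rewrite in_itv/= => /andP[].
  have tT : t0 \in `]0, T] by rewrite in_itv/= t00.
  have sub x : x \in `]0, t0[ -> x \in `]0, T[.
    by rewrite !in_itv/= => /andP[-> /lt_le_trans]; exact.
  have e0 : e t0 <= 0.
    have := ql _ tT => /cvg_lim <- //.
    apply: limr_le; first by apply/cvg_ex; exists (e t0); exact: ql.
    near=> s.
    have st : s < t0 by near: s; exact: nbhs_left_lt.
    have s0 : 0 < s by near: s; exact: nbhs_left_gt.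
    rewrite mulr_ge0_le0//; last by rewrite invr_le0 subr_le0 ltW.
    rewrite subr_ge0 tmin// in_itv/= (ltW s0)/=.
    exact: le_trans (ltW st) t0T'.
  have cv' : {within `[0, t0], continuous v}.
    apply: continuous_subspaceW cv => x /=; rewrite !in_itv/=.
    by move=> /andP[-> /le_trans]; exact.
  have hI := caputo_integral_at_min a01 t00 cv' (fun x xt => dv x (sub _ xt))
    (fun x xt => cd x (sub _ xt)) (ql _ tT) (ip _ tT).
  have {}hI : \int[leb]_(s in `[0, t0]) ((t0 - s) `^ (- alpha) * d s) <
      0.
    apply: le_lt_trans (hI _) _.
      move=> s st; apply: tmin; move: st; rewrite !in_itv/=.
      by move=> /andP[-> /le_trans]; exact.
    by rewrite oppr_lt0 mulr_gt0 ?powR_gt0// subr_gt0.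
  have h1 : c * (\int[leb]_(s in `[0, t0]) ((t0 - s) `^ (- alpha) * d s)) < 0.
    by rewrite pmulr_rlt0.
  have h2 : m t0 * e t0 <= 0 by rewrite mulr_ge0_le0// ltW// m0.
  have h3 : 0 < lambda * v t0 by have := eqv _ tT; lra.
  by move: h3; rewrite pmulr_rgt0.
have [vlt|vge] := ltP (v t0) (v 0).
  by split; [exact: ltW (key vlt)|move=> _; exact: key].
by split; [exact: le_trans v0 vge|move=> h; exact: lt_le_trans h vge].
Unshelve. all: by end_near. Qed.

(** * An exponential weight that contracts the composition of weak singularities *)

(** Trades exponential decay for a power, so that the weighted integrals below
    reduce to integrals of pure powers. *)
Lemma expRN_le_powRN {R : realType} (x b : R) : 0 < x -> 0 <= b <= 1 ->
  expR (- x) <= x `^ (- b).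
Proof.
move=> x0 /andP[b0 b1].
rewrite powRN expRN lef_pV2 ?posrE ?expR_gt0 ?powR_gt0//.
apply: le_trans (expR_ge1Dx x).
have [x1|x1] := leP x 1.
  apply: (@le_trans _ _ 1); last by rewrite lerDl ltW.
  by rewrite -(powRr0 x) ger_powR// x0.
by apply: le_trans (ler1_powR (ltW x1) b1) _; rewrite lerDr.
Qed.

(** One of the two singular factors is regular: if [z] is closer to [t], the factor
    at [a] is at most [2 `^ al * (t - a) `^ (- al)] and the exponential absorbs
    [b] powers of [t - z]; if [z] is closer to [a], the roles are exchanged, the
    exponential being then smaller than the one at distance [z - a]. *)
Lemma weak_singularity_weight {R : realType} (al b sg a t z : R) :
  0 <= al -> 0 <= b <= 1 -> 0 < sg -> a < z < t ->
  (t - z) `^ (- al) * (z - a) `^ (- al) * expR (- (sg * (t - z))) <=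
  2 `^ al * (t - a) `^ (- al) * sg `^ (- b) *
    ((t - z) `^ (- (al + b)) + (z - a) `^ (- (al + b))).
Proof.
move=> a0 b01 sg0 /andP[az zt].
have pz : 0 < z - a by rewrite subr_gt0.
have pt : 0 < t - z by rewrite subr_gt0.
have half (x : R) : (t - a) / 2 <= x -> x `^ (- al) <= 2 `^ al * (t - a) `^ (- al).
  move=> hx; have ta0 : 0 < (t - a) / 2 by lra.
  have x0 : 0 < x by exact: lt_le_trans hx.
  apply: (@le_trans _ _ (((t - a) / 2) `^ (- al))).
    rewrite !powRN lef_pV2 ?posrE ?powR_gt0//.
    by rewrite ge0_ler_powR// nnegrE ltW.
  rewrite powRM ?invr_ge0//; last by lra.
  rewrite mulrC -powR_inv1// -powRrM mulrN mulN1r opprK//.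
have expo (x : R) : 0 < x ->
    x `^ (- al) * expR (- (sg * x)) <= sg `^ (- b) * x `^ (- (al + b)).
  move=> x0; rewrite opprD powRD; last by rewrite (gt_eqF x0) implybT.
  rewrite mulrCA ler_wpM2l ?powR_ge0// -powRM ?(ltW x0) ?(ltW sg0)//.
  by apply: expRN_le_powRN => //; rewrite mulr_gt0.
have nn : forall x y : R, 0 <= x `^ y by exact: powR_ge0.
have [h|h] := leP ((t - a) / 2) (z - a).
  apply: (@le_trans _ _ ((2 `^ al * (t - a) `^ (- al)) *
      (sg `^ (- b) * (t - z) `^ (- (al + b))))).
    rewrite mulrAC mulrC; apply: ler_pM; rewrite ?mulr_ge0 ?expR_ge0//.
      exact: half.
    exact: expo.
  rewrite mulrA ler_wpM2l ?mulr_ge0// lerDl//.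
apply: (@le_trans _ _ ((2 `^ al * (t - a) `^ (- al)) *
    (sg `^ (- b) * (z - a) `^ (- (al + b))))).
  rewrite -mulrA; apply: ler_pM; rewrite ?mulr_ge0 ?expR_ge0//.
    by apply: half; lra.
  apply: le_trans (expo _ pz); rewrite ler_wpM2l// ler_expR lerN2 ler_pM2l//.
  by lra.
by rewrite mulrA ler_wpM2l ?mulr_ge0// lerDr.
Qed.

Lemma integral_weak_singularity_weight {R : realType} (al b sg T a t : R) :
  0 <= al -> 0 <= b <= 1 -> al + b < 1 -> 0 < sg -> a < t -> t - a <= T ->
  (\int[leb]_(z in `]a, t[)
    ((t - z) `^ (- al) * (z - a) `^ (- al) * expR (- (sg * (t - z))))%:E <=
   ((t - a) `^ (- al) * (2 `^ al * sg `^ (- b) *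
     (2 * (T `^ (1 - (al + b)) / (1 - (al + b))))))%:E)%E.
Proof.
move=> a0 b01 ab1 sg0 at0 atT.
set K := 2 `^ al * (t - a) `^ (- al) * sg `^ (- b).
have K0 : 0 <= K by rewrite !mulr_ge0 ?powR_ge0.
have mr : measurable_fun setT (fun z : R => (t - z) `^ (- (al + b))).
  exact: measurable_powR_subl.
have ml : measurable_fun setT (fun z : R => (z - a) `^ (- (al + b))).
  exact: measurable_powR_subr.
apply: (@le_trans _ _ (\int[leb]_(z in `]a, t[)
    (K * ((t - z) `^ (- (al + b)) + (z - a) `^ (- (al + b))))%:E)%E).
  apply: ge0_le_integral => //=.
  - by move=> z _; rewrite lee_fin !mulr_ge0 ?powR_ge0 ?expR_ge0.
  - apply/measurable_EFinP; apply: measurable_funM.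
      apply: measurable_funM; [exact: measurable_powR_subl|exact: measurable_powR_subr].
    apply: measurable_funTS; apply: (measurableT_comp (@measurable_expR R)).
    apply: measurableT_comp => //; apply: measurable_funM => //.
    exact: measurable_funB.
  - apply/measurable_EFinP; apply: measurable_funTS.
    by apply: measurable_funM => //; exact: measurable_funD.
  move=> z; rewrite in_itv/= => azt; rewrite lee_fin.
  exact: weak_singularity_weight.
under eq_integral do rewrite EFinM EFinD.
rewrite ge0_integralZl_EFin//; last 2 first.
- by move=> z _; rewrite adde_ge0// lee_fin powR_ge0.
- by apply: emeasurable_funD; apply/measurable_EFinP; exact: measurable_funTS.
rewrite ge0_integralD//; last 4 first.
- by move=> z _; rewrite lee_fin powR_ge0.
- by apply/measurable_EFinP; exact: measurable_funTS.
- by move=> z _; rewrite lee_fin powR_ge0.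
- by apply/measurable_EFinP; exact: measurable_funTS.
have mr' : measurable_fun `]a, t[ (fun z : R => ((t - z) `^ (- (al + b)))%:E).
  by apply/measurable_EFinP; exact: measurable_funTS.
have ml' : measurable_fun `]a, t[ (fun z : R => ((z - a) `^ (- (al + b)))%:E).
  by apply/measurable_EFinP; exact: measurable_funTS.
rewrite -(integral_itv_bndoo true false mr') -(integral_itv_bndoo true false ml').
rewrite integral_powR_rsing ?(ltW at0)// integral_powR_lsing ?(ltW at0)//.
rewrite -EFinD -EFinM lee_fin -mulr2n -[X in _ * X <= _]mulr_natl /K.
rewrite -!mulrA [leRHS]mulrCA ler_wpM2l ?powR_ge0// ler_wpM2l ?powR_ge0//.
rewrite !mulrA ler_pM2r ?invr_gt0 ?subr_gt0// ler_wpM2l ?mulr_ge0 ?powR_ge0//.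
have ta : 0 <= t - a by rewrite subr_ge0 ltW.
rewrite ge0_ler_powR ?nnegrE//; first by rewrite subr_ge0 ltW.
exact: le_trans atT.
Qed.

(** The bound in [integral_weak_singularity_weight] has the factor [sg `^ (- b)], which is
    arbitrarily small for large [sg]; [b = (1 - al) / 2] keeps the exponent
    [al + b] integrable. *)
Lemma exists_contracting_weight {R : realType} (C al T : R) : 0 <= C -> 0 < T ->
  0 <= al < 1 -> exists2 sg : R, 0 < sg & forall a t, a < t -> t - a <= T ->
  (\int[leb]_(z in `]a, t[)
    (C * ((t - z) `^ (- al) * (z - a) `^ (- al) * expR (- (sg * (t - z)))))%:E <=
   (2^-1 * (t - a) `^ (- al))%:E)%E.
Proof.
move=> C0 T0 /andP[a0 a1].
pose b := (1 - al) / 2.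
have b0 : 0 < b by rewrite /b; lra.
have b01 : 0 <= b <= 1 by rewrite /b; lra.
have ab1 : al + b < 1 by rewrite /b; lra.
pose K := 2 `^ al * (2 * (T `^ (1 - (al + b)) / (1 - (al + b)))).
have K0 : 0 <= K.
  by rewrite !mulr_ge0 ?powR_ge0// invr_ge0 subr_ge0 ltW.
(* With sg `^ b = X the factor C * K * sg `^ (- b) is at most a half. *)
pose X := 2 * (C * K) + 1.
have X0 : 0 < X by rewrite /X; have := mulr_ge0 C0 K0; lra.
exists (X `^ b^-1); first exact: powR_gt0.
move=> a t at0 atT.
have Xb : (X `^ b^-1) `^ (- b) = X^-1.
  by rewrite -powRrM mulrN mulVf ?gt_eqF// powR_inv1// ltW.
under eq_integral do rewrite EFinM.
rewrite ge0_integralZl_EFin//; last 2 first.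
- by move=> z _; rewrite lee_fin !mulr_ge0 ?powR_ge0 ?expR_ge0.
- apply/measurable_EFinP; apply: measurable_funM.
    apply: measurable_funM; [exact: measurable_powR_subl|exact: measurable_powR_subr].
  apply: measurable_funTS; apply: (measurableT_comp (@measurable_expR R)).
  apply: measurableT_comp => //; apply: measurable_funM => //.
  exact: measurable_funB.
apply: le_trans.
  apply: lee_wpmul2l; first by rewrite lee_fin.
  apply: (@integral_weak_singularity_weight _ al b (X `^ b^-1) T) => //.
  exact: powR_gt0.
rewrite -EFinM lee_fin Xb mulrCA [leRHS]mulrC ler_wpM2l ?powR_ge0//.
rewrite (_ : C * _ = C * K / X); last by rewrite /K; ring.
by rewrite ler_pdivrMr// /X; lra.
Qed.

(** * Iterated kernels *)

Lemma Rintegral_le_ge0 {R : realType} (D : set R) (f : R -> R) (r : R) :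
  (forall x, D x -> 0 <= f x) ->
  (\int[leb]_(x in D) (f x)%:E <= r%:E)%E -> \int[leb]_(x in D) f x <= r.
Proof.
move=> f0 fr; rewrite /Rintegral -[leRHS]/(fine r%:E) fine_le//.
rewrite ge0_fin_numE ?(le_lt_trans fr) ?ltry//.
by apply: integral_ge0 => x Dx; rewrite lee_fin f0.
Qed.

Lemma measurable_fun_comp2 {R : realType} d (X : measurableType d)
    (K : R -> R -> R) (u v : X -> measurableTypeR R) :
  measurable_fun setT
    (fun p : (measurableTypeR R * measurableTypeR R)%type => K p.1 p.2) ->
  measurable_fun setT u -> measurable_fun setT v ->
  measurable_fun setT (fun x => K (u x) (v x)).
Proof.
move=> mK mu mv.
exact: (measurableT_comp mK (measurable_fun_pair mu mv)).
Qed.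

(** The bound on the kernel is only available off the diagonal: at [s = t] the
    convention [0 `^ (- al) = 0] turns its right-hand side into 0. Hence the
    detour through the open interval. *)
Lemma weakly_singular_integral_le {R : realType} (al B t : R) (K : R -> R) :
  al < 1 -> 0 <= B -> 0 <= t -> measurable_fun setT K ->
  (forall s, 0 <= K s) ->
  (forall s, 0 <= s -> s < t -> K s <= B * (t - s) `^ (- al)) ->
  (\int[leb]_(s in `[0%R, t]) (K s)%:E <=
   (B * (t `^ (1 - al) / (1 - al)))%:E)%E.
Proof.
move=> al1 B0 t0 mK K0 KB.
have mt : measurable_fun setT (fun s : R => (t - s) `^ (- al)).
  exact: measurable_powR_subl.
have mKo : measurable_fun `]0%R, t[ (fun s => (K s)%:E).
  by apply/measurable_EFinP; exact: measurable_funTS.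
have mto : measurable_fun `]0%R, t[ (fun s => ((t - s) `^ (- al))%:E).
  by apply/measurable_EFinP; exact: measurable_funTS.
rewrite integral_itv_bndoo//.
apply: (@le_trans _ _ (\int[leb]_(s in `]0%R, t[) (B * (t - s) `^ (- al))%:E)%E).
  apply: ge0_le_integral => //=.
  - by move=> s _; rewrite lee_fin.
  - by apply/measurable_EFinP; apply: measurable_funTS; exact: measurable_funM.
  - move=> s; rewrite in_itv/= => /andP[s0 st].
    by rewrite lee_fin KB// ltW.
under eq_integral do rewrite EFinM.
rewrite ge0_integralZl_EFin//; last by move=> s _; rewrite lee_fin powR_ge0.
rewrite -(integral_itv_bndoo true false mto).
by rewrite integral_powR_rsing// subr0 EFinM.
Qed.

Lemma weakly_singular_integrableM {R : realType} (al B M t : R) (K f : R -> R) :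
  al < 1 -> 0 <= B -> 0 <= t -> measurable_fun setT K ->
  (forall s, 0 <= K s) ->
  (forall s, 0 <= s -> s < t -> K s <= B * (t - s) `^ (- al)) ->
  measurable_fun `[0, t] f -> (forall s, s \in `[0, t] -> `|f s| <= M) ->
  leb.-integrable `[0, t] (EFin \o (fun s => K s * f s)) /\
  `|\int[leb]_(s in `[0, t]) (K s * f s)| <=
    M * (B * (t `^ (1 - al) / (1 - al))).
Proof.
move=> al1 B0 t0 mK K0 KB mf fM.
have M0 : 0 <= M by apply: le_trans (fM 0 _) => //; rewrite in_itv/= lexx.
have hK := weakly_singular_integral_le al1 B0 t0 mK K0 KB.
have iK : leb.-integrable `[0, t] (EFin \o K).
  by apply: (ge0_integrable_fin _ _ _ hK) => //; exact: measurable_funTS.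
have iMK : leb.-integrable `[0, t] (EFin \o (fun s => M * K s)).
  by have := @integrableZl _ _ _ leb `[0, t] (measurable_itv _) M _ iK.
have mKf : measurable_fun `[0, t] (fun s => K s * f s).
  by apply: measurable_funM => //; exact: measurable_funTS.
have le s : s \in `[0, t] -> `|K s * f s| <= M * K s.
  by move=> st; rewrite normrM ger0_norm// mulrC ler_wpM2r// fM.
have iKf : leb.-integrable `[0, t] (EFin \o (fun s => K s * f s)).
  apply: (@le_integrable _ _ _ leb `[0, t] _ _ _ _ _ iMK) => //.
  - exact/measurable_EFinP.
  - move=> s /= st; rewrite lee_fin (le_trans (le _ st))// ler_norm//.
split=> //.
apply: le_trans (le_normr_Rintegral _ iKf) _ => //.
apply: (@le_trans _ _ (\int[leb]_(s in `[0, t]) (M * K s))).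
  apply: le_Rintegral => //; exact: integrable_norm.
rewrite RintegralZl// ler_wpM2l//.
apply: Rintegral_le_ge0 => //.
Qed.

Section iterated_kernels.
Context {R : realType}.
Notation RR := (measurableTypeR R * measurableTypeR R)%type.
Variables (H : R -> R -> R) (C al T : R).
Hypothesis mH : measurable_fun [set: RR] (fun p : RR => H p.1 p.2).
Hypothesis H0 : forall t s, 0 <= H t s.
Hypothesis T0 : 0 < T.
Hypothesis al01 : 0 <= al < 1.
Hypothesis HC : forall t s, 0 <= s -> s < t -> t <= T ->
  H t s <= C * (t - s) `^ (- al).

Lemma iterated_kernel_ge0 n t s : 0 <= iterated_kernel H n t s.
Proof.
elim: n t s => [|n IHn] t s //=.
by apply: Rintegral_ge0 => z _; rewrite mulr_ge0.
Qed.

(** Joint measurability is needed to apply Tonelli to the iterated integrals; it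
    is itself inherited by iteration from the measurability part of Tonelli. *)
Lemma measurable_iterated_kernel n :
  measurable_fun [set: RR] (fun p : RR => iterated_kernel H n p.1 p.2).
Proof.
elim: n => [|n IHn] //=.
pose F (q : RR * measurableTypeR R) : \bar R :=
  (if (q.1.2 <= q.2) && (q.2 <= q.1.1) then
    H q.1.1 q.2 * iterated_kernel H n q.2 q.1.2 else 0)%:E.
have m11 : measurable_fun setT (fun q : RR * measurableTypeR R => q.1.1).
  by apply: (measurableT_comp measurable_fst); exact: measurable_fst.
have m12 : measurable_fun setT (fun q : RR * measurableTypeR R => q.1.2).
  by apply: (measurableT_comp measurable_snd); exact: measurable_fst.
have m2 : measurable_fun setT (fun q : RR * measurableTypeR R => q.2).
  exact: measurable_snd.
have mF : measurable_fun setT F.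
  apply/measurable_EFinP; apply: measurable_fun_if => //=.
  - apply: measurable_and; exact: measurable_fun_ler.
  - apply: measurable_funTS; apply: measurable_funM.
      exact: (measurable_fun_comp2 mH m11 m2).
    exact: (measurable_fun_comp2 IHn m2 m12).
have F0 q : (0 <= F q)%E.
  by rewrite lee_fin; case: ifP => // _; rewrite mulr_ge0 ?iterated_kernel_ge0.
have := @measurable_fun_fubini_tonelli_F _ _ _ _ R leb F mF F0.
rewrite (_ : (fun p : RR => _) = fine \o fubini_F leb F).
  by move=> h; apply: measurableT_comp.
apply/funext => -[t s] /=; rewrite /Rintegral/fubini_F integral_mkcond; congr fine.
apply: eq_integral => z _; rewrite /F/= patchE.
rewrite (_ : (z \in _) = (s <= z) && (z <= t)); first by case: ifP.
by apply/idP/idP; rewrite inE/= in_itv.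
Qed.

Lemma measurable_iterated_section n t :
  measurable_fun setT (iterated_kernel H n t).
Proof.
exact: (measurable_fun_comp2 (measurable_iterated_kernel n)
  (@measurable_cst _ _ _ _ _ t) (@measurable_id _ _ _)).
Qed.

Lemma measurable_composed n t s :
  measurable_fun setT (fun z => H t z * iterated_kernel H n z s).
Proof.
apply: measurable_funM.
  exact: (measurable_fun_comp2 mH (@measurable_cst _ _ _ _ _ t) (@measurable_id _ _ _)).
exact: (measurable_fun_comp2 (measurable_iterated_kernel n)
  (@measurable_id _ _ _) (@measurable_cst _ _ _ _ _ s)).
Qed.

Lemma kernel_cst_ge0 : 0 <= C.
Proof.
have := HC (lexx 0) T0 (lexx T); rewrite subr0 => /(le_trans (H0 _ _)).
by rewrite pmulr_lge0// powR_gt0.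
Qed.

(** The induction is on the sharper bound
    [C * 2^-1 ^+ n * (t - s) `^ (- al) * expR (sg * (t - s))], whose exponential
    splits along [s <= z <= t]: the part from [z] to [t] provides the
    contracting weight. The second conclusion, on the extended integral that defines the
    next kernel, records its finiteness. *)
Lemma iterated_kernel_le : exists2 B : R, 0 <= B &
  forall n t s, 0 <= s -> s < t -> t <= T ->
    iterated_kernel H n t s <= B * 2^-1 ^+ n * (t - s) `^ (- al) /\
    (\int[leb]_(z in `[s, t]) (H t z * iterated_kernel H n z s)%:E <=
      (B * 2^-1 ^+ n.+1 * (t - s) `^ (- al))%:E)%E.
Proof.
have C0 := kernel_cst_ge0.
have [sg sg0 hsg] := exists_contracting_weight C0 T0 al01.
pose bd n t s := C * 2^-1 ^+ n * (t - s) `^ (- al) * expR (sg * (t - s)).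
have step n : (forall t s, 0 <= s -> s < t -> t <= T ->
      iterated_kernel H n t s <= bd n t s) ->
    forall t s, 0 <= s -> s < t -> t <= T ->
    (\int[leb]_(z in `[s, t]) (H t z * iterated_kernel H n z s)%:E <=
      (bd n.+1 t s)%:E)%E.
  move=> IH t s s0 st tT.
  rewrite integral_itv_bndoo; last first.
    by apply/measurable_EFinP; apply: measurable_funTS; exact: measurable_composed.
  pose c := C * 2^-1 ^+ n * expR (sg * (t - s)).
  have c0 : 0 <= c by rewrite !mulr_ge0 ?expR_ge0 ?exprn_ge0 ?invr_ge0.
  pose g z := C * ((t - z) `^ (- al) * (z - s) `^ (- al) * expR (- (sg * (t - z)))).
  have g0 z : 0 <= g z by rewrite !mulr_ge0 ?powR_ge0 ?expR_ge0.
  have mg : measurable_fun setT g.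
    apply: measurable_funM => //; apply: measurable_funM.
      by apply: measurable_funM; [exact: measurable_powR_subl|exact: measurable_powR_subr].
    apply: (measurableT_comp (@measurable_expR R)).
    apply: measurableT_comp => //; apply: measurable_funM => //.
    exact: measurable_funB.
  apply: (@le_trans _ _ (\int[leb]_(z in `]s, t[) (c * g z)%:E)%E).
    apply: ge0_le_integral => //=.
    - by move=> z _; rewrite lee_fin mulr_ge0 ?iterated_kernel_ge0.
    - by apply/measurable_EFinP; apply: measurable_funTS; exact: measurable_composed.
    - by apply/measurable_EFinP; apply: measurable_funTS; exact: measurable_funM.
    move=> z; rewrite in_itv/= => /andP[sz zt]; rewrite lee_fin.
    have z0 : 0 <= z by lra.
    have zT : z <= T by lra.
    apply: (@le_trans _ _ (C * (t - z) `^ (- al) * bd n z s)).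
      by apply: ler_pM; rewrite ?iterated_kernel_ge0 ?HC ?IH.
    rewrite /bd /c /g.
    have -> : sg * (t - s) = sg * (z - s) + sg * (t - z) by ring.
    rewrite expRD expRN; set e1 := expR (sg * (t - z)).
    have e10 : e1 != 0 by rewrite gt_eqF ?expR_gt0.
    by rewrite le_eqVlt; apply/orP; left; apply/eqP; field.
  under eq_integral do rewrite EFinM.
  rewrite ge0_integralZl_EFin//; last 2 first.
  - by move=> z _; rewrite lee_fin.
  - by apply/measurable_EFinP; exact: measurable_funTS.
  have c0E : (0 <= c%:E)%E by rewrite lee_fin.
  have tsT : t - s <= T by lra.
  apply: le_trans (lee_wpmul2l c0E (hsg s t st tsT)) _.
  rewrite -EFinM lee_fin /bd /c exprS le_eqVlt; apply/orP; left; apply/eqP; ring.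
have bdn n t s : 0 <= s -> s < t -> t <= T -> iterated_kernel H n t s <= bd n t s.
  elim: n t s => [|n IH] t s s0 st tT.
    rewrite /= /bd expr0 mulr1 (le_trans (HC s0 st tT))// ler_peMr//.
      by rewrite mulr_ge0 ?powR_ge0.
    by rewrite -expR0 ler_expR mulr_ge0 ?subr_ge0 ?ltW.
  apply: Rintegral_le_ge0; last exact: step.
  by move=> z _; rewrite mulr_ge0 ?iterated_kernel_ge0.
have bdle n t s : 0 <= s -> s < t -> t <= T ->
    bd n t s <= C * expR (sg * T) * 2^-1 ^+ n * (t - s) `^ (- al).
  move=> s0 st tT; rewrite /bd -[leRHS]mulrA [leRHS]mulrAC -!mulrA ler_wpM2l//.
  rewrite ler_wpM2l ?exprn_ge0 ?invr_ge0//.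
  by rewrite ler_wpM2l ?powR_ge0// ler_expR ler_pM2l//; lra.
exists (C * expR (sg * T)); first by rewrite mulr_ge0 ?expR_ge0.
move=> n t s s0 st tT; split;
  first exact: le_trans (bdn _ _ _ s0 st tT) (bdle _ _ _ s0 st tT).
apply: le_trans (step n (bdn n) _ _ s0 st tT) _.
by rewrite lee_fin; exact: bdle.
Qed.
End iterated_kernels.

(** * The terms of the Neumann series *)

Section neumann_series.
Context {R : realType}.
Notation RR := (measurableTypeR R * measurableTypeR R)%type.
Variables (H : R -> R -> R) (C al T : R).
Hypothesis mH : measurable_fun [set: RR] (fun p : RR => H p.1 p.2).
Hypothesis H0 : forall t s, 0 <= H t s.
Hypothesis T0 : 0 < T.
Hypothesis al01 : 0 <= al < 1.
Hypothesis HC : forall t s, 0 <= s -> s < t -> t <= T ->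
  H t s <= C * (t - s) `^ (- al).
Variables (psi : R -> R) (M : R).
Hypothesis mpsi : measurable_fun setT psi.
Hypothesis psi0 : forall s, 0 <= psi s.
Hypothesis psiM : forall s, psi s <= M.

Let al1 : al < 1. Proof. by case/andP: al01. Qed.
Let C0 : 0 <= C. Proof. exact: kernel_cst_ge0 H0 T0 HC. Qed.

Definition volterra_op (f : R -> R) (t : R) : R :=
  \int[leb]_(s in `[0, t]) (H t s * f s).

Definition neumann_term (n : nat) (t : R) : R :=
  \int[leb]_(s in `[0, t]) (iterated_kernel H n t s * psi s).

Let psi_norm t s : s \in `[0, t] -> `|psi s| <= M.
Proof. by move=> _; rewrite ger0_norm. Qed.

Lemma neumann_term_bound : exists2 B : R, 0 <= B & forall n t,
  0 <= t -> t <= T ->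
  leb.-integrable `[0, t] (EFin \o (fun s => iterated_kernel H n t s * psi s)) /\
  `|neumann_term n t| <= B * 2^-1 ^+ n.
Proof.
have [B B0 hB] := iterated_kernel_le mH H0 T0 al01 HC.
exists (M * (B * (T `^ (1 - al) / (1 - al)))).
  have M0 : 0 <= M := le_trans (psi0 0) (psiM 0).
  by rewrite !mulr_ge0 ?powR_ge0// invr_ge0 subr_ge0 ltW.
move=> n t t0 tT.
have q0 : 0 <= B * 2^-1 ^+ n by rewrite mulr_ge0 ?exprn_ge0 ?invr_ge0.
have [h1 h2] := weakly_singular_integrableM al1 q0 t0
  (measurable_iterated_section mH H0 n t) (iterated_kernel_ge0 H0 n t)
  (fun s s0 st => (hB n t s s0 st tT).1)
  (measurable_funTS mpsi) (@psi_norm t).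
split=> //; apply: le_trans h2 _.
have M0 : 0 <= M := le_trans (psi0 0) (psiM 0).
rewrite -[leRHS]mulrA ler_wpM2l// -[leLHS]mulrA -[leRHS]mulrA ler_wpM2l// [leLHS]mulrC.
rewrite ler_wpM2r ?exprn_ge0 ?invr_ge0//.
rewrite ler_wpM2r ?invr_ge0 ?subr_ge0 ?(ltW al1)//.
by apply: ge0_ler_powR; rewrite ?nnegrE ?subr_ge0 ?(ltW al1) ?(ltW T0)//.
Qed.

(** Tonelli on the triangle [0 <= s <= z <= t]. *)
Lemma neumann_termS n t : 0 <= t -> t <= T ->
  neumann_term n.+1 t = volterra_op (neumann_term n) t.
Proof.
move=> t0 tT.
have [B B0 hB] := iterated_kernel_le mH H0 T0 al01 HC.
have [B' _ hB'] := neumann_term_bound.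
pose h := iterated_kernel H n.
have h0 : forall t s, 0 <= h t s by exact: iterated_kernel_ge0.
pose F (p : RR) : \bar R :=
  (if (0 <= p.1) && ((p.1 <= p.2) && (p.2 <= t)) then
    H t p.2 * h p.2 p.1 * psi p.1 else 0)%:E.
have F0 p : (0 <= F p)%E.
  by rewrite lee_fin; case: ifP => // _; rewrite !mulr_ge0.
have mF : measurable_fun setT F.
  have m1 : measurable_fun [set: RR] (fun p : RR => p.1) by exact: measurable_fst.
  have m2 : measurable_fun [set: RR] (fun p : RR => p.2) by exact: measurable_snd.
  apply/measurable_EFinP; apply: measurable_fun_if => //=.
  - apply: measurable_and; first exact: measurable_fun_ler.
    apply: measurable_and; exact: measurable_fun_ler.
  - apply: measurable_funTS; apply: measurable_funM; first apply: measurable_funM.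
    + exact: (measurable_fun_comp2 mH (@measurable_cst _ _ _ _ _ t) m2).
    + exact: (measurable_fun_comp2 (measurable_iterated_kernel mH H0 n) m2 m1).
    + exact: (measurableT_comp mpsi m1).
have lhs : (\int[leb]_(s in `[0%R, t]) (iterated_kernel H n.+1 t s * psi s)%:E =
    \int[leb]_s \int[leb]_z F (s, z))%E.
  rewrite integral_mkcond; apply: eq_integral => s _; rewrite patchE.
  case: ifPn; rewrite ?inE/= ?notin_setE/= in_itv/=; last first.
    move=> hs; rewrite integral0_eq// => z _; rewrite /F/=; case: ifP => //.
    by move=> /and3P[s0 sz zt]; exfalso; apply: hs; rewrite s0 (le_trans sz).
  move=> /andP[s0 st].
  have Ilty : (\int[leb]_(z in `[s, t]) (H t z * h z s)%:E < +oo)%E.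
    move: st; rewrite le_eqVlt => /predU1P[->|st].
      by rewrite set_itv1 integral_set1 ltry.
    by apply: le_lt_trans (hB n t s s0 st tT).2 _; rewrite ltry.
  have I0 : (0 <= \int[leb]_(z in `[s, t]) (H t z * h z s)%:E)%E.
    by apply: integral_ge0 => z _; rewrite lee_fin mulr_ge0.
  rewrite EFinM /Rintegral fineK; last by rewrite ge0_fin_numE.
  rewrite -ge0_integralZr//=; last 3 first.
  - apply/measurable_EFinP; apply: measurable_funTS.
    exact: (measurable_composed mH H0 n t s).
  - by move=> z _; rewrite lee_fin mulr_ge0.
  - by rewrite lee_fin.
  rewrite integral_mkcond; apply: eq_integral => z _; rewrite /F/= patchE s0/=.
  rewrite (_ : (z \in _) = (s <= z) && (z <= t)); first by case: ifP.
  by apply/idP/idP; rewrite inE/= in_itv.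
have rhs : (\int[leb]_(z in `[0%R, t]) (H t z * neumann_term n z)%:E =
    \int[leb]_z \int[leb]_s F (s, z))%E.
  rewrite integral_mkcond; apply: eq_integral => z _; rewrite patchE.
  case: ifPn; rewrite ?inE/= ?notin_setE/= in_itv/=; last first.
    move=> hz; rewrite integral0_eq// => s _; rewrite /F/=; case: ifP => //.
    by move=> /and3P[s0 sz zt]; exfalso; apply: hz; rewrite zt (le_trans s0).
  move=> /andP[z0 zt].
  have [iz _] := hB' n z z0 (le_trans zt tT).
  rewrite EFinM /neumann_term /Rintegral fineK; last exact: integrable_fin_num iz.
  rewrite -ge0_integralZl//=; last 3 first.
  - exact: measurable_int iz.
  - by move=> s _; rewrite lee_fin mulr_ge0.
  - by rewrite lee_fin.
  rewrite integral_mkcond; apply: eq_integral => s _; rewrite /F/= patchE zt andbT.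
  rewrite (_ : (s \in _) = (0 <= s) && (s <= z)).
    by case: ifP => // _; rewrite -EFinM mulrA.
  by apply/idP/idP; rewrite inE/= in_itv.
rewrite /volterra_op [LHS]/neumann_term [RHS]/Rintegral [LHS]/Rintegral.
by rewrite lhs rhs (fubini_tonelli F mF F0).
Qed.
End neumann_series.

(** * Continuity of fractional integrals *)

Definition clamp {R : realType} (T x : R) : R := Num.max 0 (Num.min x T).

Section clamp.
Context {R : realType}.
Variable T : R.
Hypothesis T0 : 0 <= T.

Lemma clamp_itv x : clamp T x \in `[0, T].
Proof.
by rewrite /clamp in_itv/= le_max lexx/= ge_max T0/= ge_min lexx orbT.
Qed.

Lemma clamp_id x : x \in `[0, T] -> clamp T x = x.
Proof. by rewrite in_itv/= => /andP[x0 xT]; rewrite /clamp min_l// max_r. Qed.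

Lemma clamp_nondecreasing_le x y : x <= y ->
  clamp T x <= clamp T y /\ clamp T y - clamp T x <= y - x.
Proof.
have T0' := T0; move=> xy; rewrite /clamp; case: (leP x T) => h1; case: (leP y T) => h2;
case: (leP 0 x) => h3; case: (leP 0 y) => h4; rewrite ?(max_r T0); split; lra.
Qed.
End clamp.

(** [clamp T] is 1-Lipschitz with values in [0, T], so composing with it turns
    uniform continuity on [0, T] into continuity on the line. *)
Lemma uniform_clamp_continuous {R : realType} (T : R) (J : R -> R) : 0 <= T ->
  (forall e, 0 < e -> exists2 d, 0 < d & forall x y,
    0 <= x -> x <= y -> y <= T -> y - x < d -> `|J y - J x| < e) ->
  continuous (J \o clamp T).
Proof.
move=> T0 hJ x.
apply/cvgrPdist_lt => e e0; have [d d0 hd] := hJ e e0.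
have key u v : `|u - v| < d -> `|J (clamp T u) - J (clamp T v)| < e.
  wlog uv : u v / u <= v.
    move=> h; have [uv|/ltW vu] := leP u v; first exact: h.
    by rewrite (distrC (J _)) (distrC u); exact: h.
  have [h1 h2] := clamp_nondecreasing_le T0 uv.
  have := clamp_itv T0 u; have := clamp_itv T0 v.
  rewrite !in_itv/= => /andP[_ cvT] /andP[cu0 _].
  rewrite distrC ger0_norm ?subr_ge0// distrC => uvd.
  exact: hd cu0 h1 cvT (le_lt_trans h2 uvd).
by apply/nbhs_ballP; exists d => //= y; exact: key.
Qed.

Lemma clamp_continuous {R : realType} (T : R) : 0 <= T -> continuous (clamp T).
Proof.
move=> T0; apply: (@uniform_clamp_continuous _ T id T0) => e e0.
by exists e => // x y _ xy _; rewrite ger0_norm ?subr_ge0.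
Qed.

Lemma continuous_comp_clamp {R : realType} (T : R) (J : R -> R) : 0 <= T ->
  {within `[0, T], continuous J} -> continuous (J \o clamp T).
Proof.
move=> T0 cJ x P hP.
have cxT : `[0, T]%classic (clamp T x) by exact: clamp_itv.
have hw : within `[0, T]%classic (nbhs (clamp T x)) (J @^-1` P).
  by rewrite (nbhs_subspace_in cxT); exact: cJ hP.
have hc : nbhs x (fun y => clamp T y \in `[0, T] -> P (J (clamp T y))).
  exact: clamp_continuous T0 _ _ hw.
change (nbhs x (fun y => P (J (clamp T y)))).
by apply: filterS hc => y; apply; exact: clamp_itv.
Qed.

Lemma uniform_within_continuous {R : realType} (T : R) (J : R -> R) : 0 <= T ->
  (forall e, 0 < e -> exists2 d, 0 < d & forall x y,
    0 <= x -> x <= y -> y <= T -> y - x < d -> `|J y - J x| < e) ->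
  {within `[0, T], continuous J}.
Proof.
move=> T0 hJ; apply: (@subspace_eq_continuous _ _ _ (J \o clamp T)).
  by move=> x; rewrite inE /= => xT; rewrite clamp_id.
by apply: continuous_subspaceT => x; exact: uniform_clamp_continuous.
Qed.

Lemma holder_within_continuous {R : realType} (L p T : R) (J : R -> R) :
  0 <= L -> 0 < p -> 0 <= T ->
  (forall x y, 0 <= x -> x <= y -> y <= T -> `|J y - J x| <= L * (y - x) `^ p) ->
  {within `[0, T], continuous J}.
Proof.
move=> L0 p0 T0 hJ; apply: uniform_within_continuous => // e e0.
have L1 : 0 < L + 1 by lra.
have eL : 0 < e / (L + 1) by rewrite divr_gt0.
exists ((e / (L + 1)) `^ p^-1); first exact: powR_gt0.
move=> x y x0 xy yT d; apply: le_lt_trans (hJ _ _ x0 xy yT) _.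
apply: (@le_lt_trans _ _ (L * (e / (L + 1)))).
  rewrite ler_wpM2l//.
  have -> : e / (L + 1) = ((e / (L + 1)) `^ p^-1) `^ p.
    by rewrite -powRrM mulVf ?gt_eqF// powRr1// ltW.
  by apply: ge0_ler_powR; rewrite ?nnegrE ?powR_ge0 ?subr_ge0 ?(ltW p0) ?(ltW d).
by rewrite mulrA ltr_pdivrMr// mulrDr mulr1 mulrC ltrDl.
Qed.

(** The Riemann-Liouville integral of order [1 - g], up to the factor
    [Gamma (1 - g)]. *)
Definition fractional_integral {R : realType} (g : R) (f : R -> R) (t : R) : R :=
  \int[leb]_(s in `[0, t]) ((t - s) `^ (- g) * f s).

Lemma Rintegral_powR_rsing {R : realType} (g a b : R) : g < 1 -> a <= b ->
  \int[leb]_(s in `[a, b]) ((b - s) `^ (- g)) = (b - a) `^ (1 - g) / (1 - g).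
Proof. by move=> g1 ab; rewrite /Rintegral integral_powR_rsing. Qed.

(** Split the integral at [x]. The tail from [x] to [y] is at most
    [M * (y - x) `^ (1 - g) / (1 - g)]. Below [x] the kernel decreases when the
    upper end moves from [x] to [y], so the absolute value of the difference can
    be integrated exactly, and the result has the same bound. *)
Lemma fractional_integral_holder {R : realType} (g M T x y : R) (f : R -> R) :
  0 <= g < 1 -> measurable_fun `[0, T] f ->
  (forall s, s \in `[0, T] -> `|f s| <= M) ->
  0 <= x -> x <= y -> y <= T ->
  `|fractional_integral g f y - fractional_integral g f x| <=
    2 * M / (1 - g) * (y - x) `^ (1 - g).
Proof.
move=> /andP[g0 g1] mf fM x0 xy yT.
have y0 : 0 <= y := le_trans x0 xy.
have g1' : 0 < 1 - g by rewrite subr_gt0.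
have M0 : 0 <= M.
  by apply: le_trans (fM 0 _) => //; rewrite in_itv/= lexx (le_trans y0).
pose k (u s : R) := (u - s) `^ (- g).
have k0 u s : 0 <= k u s by exact: powR_ge0.
have mk u D : measurable_fun D (k u) by exact: measurable_powR_subl.
have sub u : u <= T -> `[0, u] `<=` `[0, T].
  by move=> uT; apply: subset_itvl; rewrite bnd_simp.
have ik u : leb.-integrable `[0, u] (EFin \o k u) by exact: integrable_powR_rsing.
have ikf u : 0 <= u -> u <= T ->
    leb.-integrable `[0, u] (EFin \o (fun s => k u s * f s)).
  move=> u0 uT.
  have [] := @weakly_singular_integrableM _ g 1 M u (k u) f g1 ler01 u0 (mk u _)
    (k0 u) _ _ _ => //.
  - by move=> s _ _; rewrite mul1r.
  - by apply: measurable_funS mf => //; exact: sub.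
  - by move=> s /sub; apply: (fun h => fM _ (h uT)).
have ikf' : leb.-integrable `[0, x] (EFin \o (fun s => k y s * f s)).
  by apply: integrableS (ikf y y0 yT) => //; apply: subset_itvl; rewrite bnd_simp.
have ik' : leb.-integrable `[0, x] (EFin \o k y).
  by apply: integrableS (ik y) => //; apply: subset_itvl; rewrite bnd_simp.
have E1 : fractional_integral g f y - fractional_integral g f x =
    (\int[leb]_(s in `]x, y]) (k y s * f s)) +
    (\int[leb]_(s in `[0, x]) (k y s * f s - k x s * f s)).
  rewrite RintegralB//; last by apply: ikf => //; exact: le_trans yT.
  rewrite -(Rintegral_itvB (ikf y y0 yT)) ?bnd_simp//.
  by rewrite /fractional_integral; ring.
rewrite E1; apply: le_trans (ler_normD _ _) _.
have split (u : R) : 2 * M / (1 - g) * u = M * (u / (1 - g)) + M * (u / (1 - g)).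
  by field; rewrite gt_eqF.
rewrite {}split; apply: lerD.
- have sub2 : `]x, y] `<=` `[0, y].
    by apply: subset_itvr; rewrite bnd_simp.
  have i1 : leb.-integrable `]x, y] (EFin \o (fun s => k y s * f s)).
    by apply: integrableS (ikf y y0 yT).
  have i2 : leb.-integrable `]x, y] (EFin \o (fun s => k y s)).
    by apply: integrableS (ik y).
  apply: le_trans (le_normr_Rintegral _ i1) _ => //.
  apply: (@le_trans _ _ (\int[leb]_(s in `]x, y]) (M * k y s))).
    apply: le_Rintegral => //; first exact: integrable_norm.
      by have := @integrableZl _ _ _ leb `]x, y] (measurable_itv _) M _ i2.
    move=> s /= sxy; rewrite normrM ger0_norm// mulrC ler_wpM2r// fM//.
    by apply: (sub y) => //; exact: sub2.
  rewrite RintegralZl// ler_wpM2l// Rintegral_itv_obnd_cbnd//.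
  by rewrite Rintegral_powR_rsing.
- have mI : @measurable _ (measurableTypeR R) `[0, x] by exact: measurable_itv.
  have sub2 : `[0, x[ `<=` `[0, x].
    by apply: subset_itvl; rewrite bnd_simp.
  have i1 : leb.-integrable `[0, x[ (EFin \o (fun s => k y s * f s - k x s * f s)).
    have xT := le_trans xy yT.
    apply: (@integrableS _ _ _ leb `[0, x]) => //.
    by have := integrableB mI ikf' (ikf x x0 xT).
  have i2 : leb.-integrable `[0, x[ (EFin \o (fun s => k x s - k y s)).
    apply: (@integrableS _ _ _ leb `[0, x]) => //.
    by have := integrableB mI (ik x) ik'.
  rewrite -Rintegral_itv_bndo_bndc//.
  apply: le_trans (le_normr_Rintegral _ i1) _ => //.
  apply: (@le_trans _ _ (\int[leb]_(s in `[0, x[) (M * (k x s - k y s)))).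
    apply: le_Rintegral => //; first exact: integrable_norm.
      by have := @integrableZl _ _ _ leb `[0, x[ (measurable_itv _) M _ i2.
    move=> s /=; rewrite in_itv/= => /andP[s0 sx].
    rewrite -mulrBl normrM mulrC; apply: ler_pM => //.
      by apply: fM; rewrite in_itv/= s0/= (le_trans (ltW sx))// (le_trans xy).
    rewrite distrC ger0_norm//.
    rewrite subr_ge0 /k !powRN lef_pV2 ?posrE ?powR_gt0 ?subr_gt0//; last first.
      exact: lt_le_trans xy.
    rewrite ge0_ler_powR ?nnegrE ?subr_ge0 ?(ltW sx)//; lra.
  rewrite RintegralZl// ler_wpM2l// Rintegral_itv_bndo_bndc// RintegralB//.
  have E2 : \int[leb]_(s in `[0, x]) k y s =
      (y `^ (1 - g) - (y - x) `^ (1 - g)) / (1 - g).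
    have := Rintegral_itvB (ik y) (x := x); rewrite !bnd_simp => /(_ x0 xy).
    have i3 : leb.-integrable `]x, y] (EFin \o k y).
      by apply: integrableS (ik y) => //; apply: subset_itvr; rewrite bnd_simp.
    rewrite (Rintegral_itv_obnd_cbnd i3) !Rintegral_powR_rsing// subr0 mulrBl.
    by lra.
  rewrite E2 Rintegral_powR_rsing// subr0 -mulrBl ler_pM2r ?invr_gt0//.
  rewrite opprB addrCA gerDl subr_le0 ge0_ler_powR ?nnegrE ?(ltW g1')//.
Qed.

Lemma fractional_integral_continuous {R : realType} (g M T : R) (f : R -> R) :
  0 <= g < 1 -> 0 <= T -> measurable_fun `[0, T] f ->
  (forall s, s \in `[0, T] -> `|f s| <= M) ->
  {within `[0, T], continuous (fractional_integral g f)}.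
Proof.
move=> g01 T0 mf fM; have /andP[g0 g1] := g01.
have M0 : 0 <= M by apply: le_trans (fM 0 _) => //; rewrite in_itv/= lexx.
apply: (@holder_within_continuous _ (2 * M / (1 - g)) (1 - g)) => //.
- by rewrite !mulr_ge0// invr_ge0 subr_ge0 ltW.
- by rewrite subr_gt0.
- by move=> x y x0 xy yT; exact: fractional_integral_holder mf fM x0 xy yT.
Qed.

(** * The resolvent *)

Section half_geometric_series.
Context {R : realType}.
Variables (u : R^nat) (B : R).
Hypothesis uB : forall n, `|u n| <= B * 2^-1 ^+ n.

Let B0 : 0 <= B.
Proof. by have := uB 0; rewrite expr0 mulr1; apply: le_trans. Qed.

Lemma half_geometric_series_tail N k :
  `|series u (N + k)%N - series u N| <= 2 * B * 2^-1 ^+ N.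
Proof.
have pow n : 0 <= 2^-1 ^+ n :> R by rewrite exprn_ge0 ?invr_ge0.
suff : `|series u (N + k)%N - series u N| <=
    2 * B * (2^-1 ^+ N - 2^-1 ^+ (N + k)%N).
  move/le_trans; apply; rewrite ler_wpM2l ?mulr_ge0//.
  by rewrite gerBl.
elim: k => [|k IH]; first by rewrite addn0 !subrr normr0 mulr0.
rewrite addnS {1}/series/= big_nat_recr//= -/(series u (N + k)%N) addrAC.
apply: le_trans (ler_normD _ _) _.
apply: le_trans (lerD IH (uB _)) _.
by rewrite exprS le_eqVlt; apply/orP; left; apply/eqP; field.
Qed.

Lemma half_geometric_series_le N : `|series u N| <= 2 * B.
Proof.
have := half_geometric_series_tail 0 N.
by rewrite add0n expr0 mulr1 {2}/series/= big_geq// subr0.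
Qed.

Lemma is_cvg_half_geometric_series : cvgn (series u).
Proof.
apply: normed_cvg.
apply: (@series_le_cvg _ _ (geometric B 2^-1)) => //.
- by move=> n /=.
- by move=> n; rewrite /geometric/= mulr_ge0 // exprn_ge0 // invr_ge0.
- apply: is_cvg_geometric_series; rewrite ger0_norm ?invr_ge0// invf_lt1//.
  by rewrite ltr1n.
Qed.

Lemma half_geometric_series_lim N l : series u @ \oo --> l ->
  `|l - series u N| <= 2 * B * 2^-1 ^+ N.
Proof.
move=> ul.
have h : `|series u (n + N)%N - series u N| @[n --> \oo] --> `|l - series u N|.
  apply: cvg_norm; apply: cvgB; last exact: cvg_cst.
  by rewrite (@cvg_shiftn N _ (series u)).
rewrite -(cvg_lim _ h)//; apply: limr_le; first by apply/cvg_ex; eexists; exact: h.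
by apply: nearW => n; rewrite addnC; exact: half_geometric_series_tail.
Qed.
End half_geometric_series.

Lemma eq0_half_geometric {R : realType} (x K : R) :
  (forall n, `|x| <= K * 2^-1 ^+ n) -> x = 0.
Proof.
move=> h; apply/eqP; rewrite -normr_le0.
have c : K * 2^-1 ^+ n @[n --> \oo] --> K * 0.
  apply: cvgM; first exact: cvg_cst.
  apply: cvg_expr; rewrite ger0_norm ?invr_ge0// invf_lt1//.
  by rewrite ltr1n.
rewrite mulr0 in c; rewrite -(cvg_lim _ c)//; apply: limr_ge.
  by apply/cvg_ex; eexists; exact: c.
by apply: nearW => n; exact: h.
Qed.

Section resolvent.
Context {R : realType}.
Notation RR := (measurableTypeR R * measurableTypeR R)%type.
Variables (H : R -> R -> R) (C al T : R).
Hypothesis mH : measurable_fun [set: RR] (fun p : RR => H p.1 p.2).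
Hypothesis H0 : forall t s, 0 <= H t s.
Hypothesis T0 : 0 < T.
Hypothesis al01 : 0 <= al < 1.
Hypothesis HC : forall t s, 0 <= s -> s < t -> t <= T ->
  H t s <= C * (t - s) `^ (- al).
Hypothesis HV : forall (f : R -> R) (M : R), measurable_fun `[0, T] f ->
  (forall s, s \in `[0, T] -> `|f s| <= M) ->
  {within `[0, T], continuous (volterra_op H f)}.
Variables (psi : R -> R) (M : R).
Hypothesis mpsi : measurable_fun setT psi.
Hypothesis psi0 : forall s, 0 <= psi s.
Hypothesis psiM : forall s, psi s <= M.

Let al1 : al < 1. Proof. by case/andP: al01. Qed.
Let C0 : 0 <= C. Proof. exact: kernel_cst_ge0 H0 T0 HC. Qed.
Let M0 : 0 <= M. Proof. exact: le_trans (psi0 0) (psiM 0). Qed.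

Let signed_term t n : R := (-1) ^+ n.+1 * neumann_term H psi n t.

Definition neumann_sum (N : nat) (t : R) : R := series (signed_term t) N.

Definition resolvent_integral (t : R) : R :=
  \int[leb]_(s in `[0, t]) (resolvent_kernel H t s * psi s).

Let sumS N t : neumann_sum N.+1 t = neumann_sum N t + signed_term t N.
Proof. by rewrite /neumann_sum /series/= big_nat_recr. Qed.

Let sum0 t : neumann_sum 0 t = 0.
Proof. by rewrite /neumann_sum /series/= big_geq. Qed.

Let normr_sign n (x : R) : `|(-1) ^+ n * x| = `|x|.
Proof. by rewrite normrM normrX normrN1 expr1n mul1r. Qed.

Lemma volterra_op_bound (f : R -> R) (e t : R) : 0 <= t -> t <= T ->
  measurable_fun `[0, T] f -> (forall s, s \in `[0, T] -> `|f s| <= e) ->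
  leb.-integrable `[0, t] (EFin \o (fun s => H t s * f s)) /\
  `|volterra_op H f t| <= e * (C * (T `^ (1 - al) / (1 - al))).
Proof.
move=> t0 tT mf fe.
have sub : `[0, t] `<=` `[0, T] by apply: subset_itvl; rewrite bnd_simp.
have e0 : 0 <= e.
  by apply: le_trans (fe 0 _) => //; rewrite in_itv/= lexx ltW.
have mHt : measurable_fun setT (H t).
  exact: (measurable_fun_comp2 mH (@measurable_cst _ _ _ _ _ t) (@measurable_id _ _ _)).
have mft : measurable_fun `[0, t] f by apply: measurable_funS mf.
have fet s : s \in `[0, t] -> `|f s| <= e by move=> st; apply: fe; exact: sub.
have [h1 h2] := weakly_singular_integrableM al1 C0 t0 mHt (H0 t)
  (fun s s0 st => HC s0 st tT) mft fet.
split=> //; apply: le_trans h2 _; rewrite ler_wpM2l// ler_wpM2l//.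
rewrite ler_wpM2r ?invr_ge0 ?subr_ge0 ?(ltW al1)//.
by apply: ge0_ler_powR; rewrite ?nnegrE ?subr_ge0 ?(ltW al1) ?(ltW T0)//.
Qed.

Let within_measurable (f : R -> R) : {within `[0, T], continuous f} ->
  measurable_fun `[0, T] f.
Proof. by move=> cf; apply: subspace_continuous_measurable_fun. Qed.

Let psi_norm s : s \in `[0, T] -> `|psi s| <= M.
Proof. by move=> _; rewrite ger0_norm. Qed.

Lemma neumann_term_continuous n : {within `[0, T], continuous (neumann_term H psi n)}.
Proof.
have [B B0 hB] := neumann_term_bound mH H0 T0 al01 HC mpsi psi0 psiM.
elim: n => [|n IH].
  by apply: HV; [exact: measurable_funTS|exact: psi_norm].
apply: (@subspace_eq_continuous _ _ _ (volterra_op H (neumann_term H psi n))).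
  move=> t; rewrite inE/= in_itv/= => /andP[t0 tT].
  by rewrite -(neumann_termS mH H0 T0 al01 HC mpsi psi0 psiM).
apply: (HV (M := B * 2^-1 ^+ n)); first exact: within_measurable.
by move=> s; rewrite in_itv/= => /andP[s0 sT]; have [] := hB n s s0 sT.
Qed.

Lemma neumann_sum_measurable N : measurable_fun `[0, T] (neumann_sum N).
Proof.
elim: N => [|N IH].
  rewrite (_ : neumann_sum 0 = cst 0); first exact: measurable_cst.
  by apply/funext => t; exact: sum0.
rewrite (_ : neumann_sum N.+1 = fun t => neumann_sum N t + signed_term t N); last first.
  by apply/funext => t; exact: sumS.
apply: measurable_funD => //; apply: measurable_funM => //.
by apply: within_measurable; exact: neumann_term_continuous.
Qed.

(** Applying the operator shifts the alternating series by one term, with a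
    change of sign. *)
Lemma neumann_sumS N t : 0 <= t -> t <= T ->
  neumann_sum N.+1 t = - (volterra_op H psi t + volterra_op H (neumann_sum N) t).
Proof.
move=> t0 tT.
have [B B0 hB] := neumann_term_bound mH H0 T0 al01 HC mpsi psi0 psiM.
have hs s : s \in `[0, T] -> forall n, `|signed_term s n| <= B * 2^-1 ^+ n.
  rewrite in_itv/= => /andP[s0 sT] n; rewrite /signed_term normr_sign.
  by have [] := hB n s s0 sT.
elim: N => [|N IH].
  rewrite sumS sum0 add0r /signed_term expr1 mulN1r; congr (- _).
  rewrite [X in _ = _ + X](_ : _ = 0) ?addr0//.
  rewrite /volterra_op; under eq_Rintegral do rewrite sum0 mulr0.
  by rewrite Rintegral_cst// mul0r.
suff key : volterra_op H (neumann_sum N.+1) t =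
    volterra_op H (neumann_sum N) t - signed_term t N.+1.
  by rewrite sumS IH key; ring.
have mT n : measurable_fun `[0, T] (neumann_term H psi n).
  by apply: within_measurable; exact: neumann_term_continuous.
have [i1 _] := volterra_op_bound t0 tT (@neumann_sum_measurable N)
  (fun s sT => half_geometric_series_le (hs s sT) N).
have b2 s : s \in `[0, T] -> `|signed_term s N| <= B * 2^-1 ^+ N by move/hs.
have [i2 _] : leb.-integrable `[0, t] (EFin \o (fun s => H t s * signed_term s N)) /\ _
  := volterra_op_bound t0 tT (measurable_funM (measurable_cst _) (mT N)) b2.
have b3 s : s \in `[0, T] -> `|neumann_term H psi N s| <= B * 2^-1 ^+ N.
  by rewrite in_itv/= => /andP[s0 sT]; have [] := hB N s s0 sT.
have [i3 _] := volterra_op_bound t0 tT (mT N) b3.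
rewrite {1}/volterra_op; under eq_Rintegral do rewrite sumS mulrDr.
rewrite RintegralD//; congr (_ + _).
rewrite /signed_term (neumann_termS mH H0 T0 al01 HC mpsi psi0 psiM)//.
rewrite [in RHS]exprS mulN1r mulNr opprK.
under eq_Rintegral do rewrite mulrCA.
by rewrite RintegralZl.
Qed.

(** Dominated convergence, the partial sums of the resolvent series being bounded
    by [2 * B * (t - s) `^ (- al)] off the diagonal. *)
Lemma neumann_sum_cvg t : 0 <= t -> t <= T ->
  neumann_sum N t @[N --> \oo] --> resolvent_integral t.
Proof.
move=> t0 tT.
have [B B0 hB] := iterated_kernel_le mH H0 T0 al01 HC.
have [B' _ hB'] := neumann_term_bound mH H0 T0 al01 HC mpsi psi0 psiM.
pose u s n : R := (-1) ^+ n.+1 * iterated_kernel H n t s.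
have uB s : 0 <= s -> s < t -> forall n, `|u s n| <= B * (t - s) `^ (- al) * 2^-1 ^+ n.
  move=> s0 st n; rewrite /u normr_sign ger0_norm ?iterated_kernel_ge0//.
  by rewrite mulrAC; have [] := hB n t s s0 st tT.
have kS N s : series (u s) N.+1 * psi s =
    series (u s) N * psi s + (-1) ^+ N.+1 * (iterated_kernel H N t s * psi s).
  by rewrite {1}/series/= big_nat_recr//= mulrDl -mulrA.
have kI N : leb.-integrable `[0, t] (EFin \o (fun s => series (u s) N * psi s)) /\
    \int[leb]_(s in `[0, t]) (series (u s) N * psi s) = neumann_sum N t.
  have mI : @measurable _ (measurableTypeR R) `[0, t] by exact: measurable_itv.
  elim: N => [|N [IH1 IH2]].
    have E s : series (u s) 0%N * psi s = 0 by rewrite /series/= big_geq// mul0r.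
    split.
      apply: eq_integrable (integrable0 _ _) => // s _.
      by rewrite /= E.
    by under eq_Rintegral do rewrite E; rewrite sum0 Rintegral_cst// mul0r.
  have [i1 _] := hB' N t t0 tT.
  have i2 : leb.-integrable `[0, t]
      (EFin \o (fun s => (-1) ^+ N.+1 * (iterated_kernel H N t s * psi s))).
    by have := integrableZl mI ((-1) ^+ N.+1) i1.
  split.
    have := integrableD mI IH1 i2.
    by apply: eq_integrable => // s _; rewrite /= kS.
  under eq_Rintegral do rewrite kS.
  by rewrite RintegralD// IH2 RintegralZl// sumS.
have mI : @measurable _ (measurableTypeR R) `[0, t[ by exact: measurable_itv.
have sub : `[0, t[ `<=` `[0, t] by apply: subset_itvl; rewrite bnd_simp.
have kI' N : leb.-integrable `[0, t[ (EFin \o (fun s => series (u s) N * psi s)).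
  by apply: (@integrableS _ _ _ leb `[0, t]) => //; exact: (kI N).1.
have kcvg (s : R) : (`[0, t[%classic : set R) s -> series (u s) N * psi s @[N --> \oo] -->
    resolvent_kernel H t s * psi s.
  rewrite /= in_itv/= => /andP[s0 st]; apply: cvgM; last exact: cvg_cst.
  exact: is_cvg_half_geometric_series (uB s s0 st).
have mk N : measurable_fun `[0, t[ (fun s => series (u s) N * psi s).
  by apply/measurable_EFinP; exact: measurable_int (kI' N).
have mR : measurable_fun `[0, t[ (fun s => resolvent_kernel H t s * psi s).
  exact: measurable_fun_cvg mk kcvg.
pose g s : R := 2 * B * M * (t - s) `^ (- al).
have ig : leb.-integrable `[0, t[ (EFin \o g).
  apply: (@integrableS _ _ _ leb `[0, t]) => //.
  by have := @integrableZl _ _ _ leb `[0, t] (measurable_itv _) (2 * B * M) _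
    (integrable_powR_rsing 0 t al1).
have [] := @dominated_convergence _ _ _ leb `[0, t[ mI
  (fun N => EFin \o (fun s => series (u s) N * psi s))
  (EFin \o (fun s => resolvent_kernel H t s * psi s)) (EFin \o g).
- by move=> N; apply/measurable_EFinP; exact: mk.
- by apply/measurable_EFinP; exact: mR.
- by apply: aeW => s /kcvg h; apply: cvg_EFin => //; exact: nearW.
- exact: ig.
- apply: aeW => s N /=; rewrite in_itv/= => /andP[s0 st]; rewrite lee_fin normrM.
  rewrite (ger0_norm (psi0 s)) /g -mulrA [M * _]mulrC mulrA.
  apply: ler_pM => //.
  by rewrite -mulrA; exact: half_geometric_series_le (uB s s0 st) N.
move=> iR _ cvgI.
rewrite /resolvent_integral -Rintegral_itv_bndo_bndc//.
have {}cvgI : (\int[leb]_(s in `[0%R, t[) (series (u s) N * psi s)%R%:E)%E @[N --> \oo] -->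
    (\int[leb]_(s in `[0, t[) (resolvent_kernel H t s * psi s))%:E.
  rewrite /Rintegral fineK; first exact: cvgI.
  exact: integrable_fin_num iR.
have {}cvgI : \int[leb]_(s in `[0, t[) (series (u s) N * psi s) @[N --> \oo] -->
    \int[leb]_(s in `[0, t[) (resolvent_kernel H t s * psi s).
  exact: fine_cvg cvgI.
rewrite (_ : neumann_sum ^~ t =
  fun N => \int[leb]_(s in `[0, t[) (series (u s) N * psi s)) //.
by apply/funext => N; rewrite -(kI N).2 -Rintegral_itv_bndo_bndc.
Qed.

Let signed_term_bound : exists B : R, forall s, s \in `[0, T] ->
  forall n, `|signed_term s n| <= B * 2^-1 ^+ n.
Proof.
have [B B0 hB] := neumann_term_bound mH H0 T0 al01 HC mpsi psi0 psiM.
exists B => s; rewrite in_itv/= => /andP[s0 sT] n; rewrite /signed_term normr_sign.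
by have [] := hB n s s0 sT.
Qed.

Lemma resolvent_integral_measurable : measurable_fun `[0, T] resolvent_integral.
Proof.
apply: (measurable_fun_cvg neumann_sum_measurable) => t /=.
by rewrite in_itv/= => /andP[t0 tT]; exact: neumann_sum_cvg.
Qed.

Lemma resolvent_integral_bounded : exists K : R, forall s, s \in `[0, T] ->
  `|resolvent_integral s| <= K.
Proof.
have [B hB] := signed_term_bound; exists (2 * B) => s sT.
have /andP[s0 sT'] : 0 <= s <= T by move: sT; rewrite in_itv.
have := half_geometric_series_lim (hB s sT) 0 (neumann_sum_cvg s0 sT').
by rewrite -/(neumann_sum 0 s) sum0 subr0 expr0 mulr1.
Qed.

(** The limit of [neumann_sumS], the convergence of the partial sums being
    uniform on [0, T]. *)
Lemma resolvent_integral_eq t : 0 <= t -> t <= T ->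
  resolvent_integral t =
    - (volterra_op H psi t + volterra_op H resolvent_integral t).
Proof.
move=> t0 tT.
have [B hB] := signed_term_bound.
have tT' : t \in `[0, T] by rewrite in_itv/= t0.
have tail N s : s \in `[0, T] ->
    `|resolvent_integral s - neumann_sum N s| <= 2 * B * 2^-1 ^+ N.
  move=> sT; have /andP[s0 sT1] : 0 <= s <= T by move: sT; rewrite in_itv.
  by have := half_geometric_series_lim (hB s sT) N (neumann_sum_cvg s0 sT1).
have mR := resolvent_integral_measurable.
have [K RK] := resolvent_integral_bounded.
have [iR _] := volterra_op_bound t0 tT mR RK.
pose V0 := C * (T `^ (1 - al) / (1 - al)).
apply/eqP; rewrite -subr_eq0; apply/eqP.
apply: (@eq0_half_geometric _ _ (B + 2 * B * V0)) => N.
have mS := neumann_sum_measurable N.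
have [iS _] := volterra_op_bound t0 tT mS
  (fun s sT => half_geometric_series_le (hB s sT) N).
have [_ dV] := volterra_op_bound t0 tT (measurable_funB mR mS) (tail N).
have E : volterra_op H (resolvent_integral \- neumann_sum N) t =
    volterra_op H resolvent_integral t - volterra_op H (neumann_sum N) t.
  rewrite /volterra_op; under eq_Rintegral do rewrite /= mulrBr.
  by rewrite RintegralB.
have t1 := tail N.+1 t tT'.
rewrite (neumann_sumS N t0 tT) in t1.
have -> : resolvent_integral t -
    - (volterra_op H psi t + volterra_op H resolvent_integral t) =
   (resolvent_integral t - - (volterra_op H psi t + volterra_op H (neumann_sum N) t))
   + volterra_op H (resolvent_integral \- neumann_sum N) t.
  by rewrite E; ring.
apply: le_trans (ler_normD _ _) _; apply: le_trans (lerD t1 dV) _.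
by rewrite exprS /V0 le_eqVlt; apply/orP; left; apply/eqP; field; rewrite subr_eq0 gt_eqF.
Qed.

(** By [resolvent_integral_eq] the function is the image under the operator of
    bounded measurable functions. *)
Lemma resolvent_integral_continuous : {within `[0, T], continuous resolvent_integral}.
Proof.
have [K RK] := resolvent_integral_bounded.
apply: (@subspace_eq_continuous _ _ _
  (fun t => - (volterra_op H psi t + volterra_op H resolvent_integral t))).
  move=> t; rewrite inE/= in_itv/= => /andP[t0 tT].
  by rewrite -resolvent_integral_eq.
move=> x; apply: cvgN; apply: cvgD.
  by apply: (HV (M := M)) => //; exact: measurable_funTS.
by apply: (HV (M := K)) => //; exact: resolvent_integral_measurable.
Qed.
End resolvent.

(** * The Volterra equation of the mode problem *)

Section mode_volterra.
Context {R : realType}.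
Notation RR := (measurableTypeR R * measurableTypeR R)%type.
Variables (alpha lambda mu0 : R) (mu : R -> R).
Hypothesis a01 : 0 < alpha < 1.
Hypothesis lambda0 : 0 < lambda.
Hypothesis mu00 : 0 < mu0.
Hypothesis cmu : continuous mu.
Hypothesis mu_ge : forall t, mu0 <= mu t.

Let H := mode_kernel alpha mu lambda.
Let psi (t : R) := (mu t)^-1.
Let gam := Gamma (1 - alpha).

Let gam0 : 0 < gam. Proof. exact: Gamma_gt0. Qed.
Let mu_gt0 t : 0 < mu t. Proof. exact: lt_le_trans (mu_ge t). Qed.
Let a01' : 0 <= alpha < 1. Proof. by case/andP: a01 => /ltW -> ->. Qed.

(** The solution [Y] of [Y + V Y = - psi], with [V] the integral operator of
    [H]. *)
Definition mode_derivative (t : R) : R := - (psi t + resolvent_integral H psi t).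

Let cpsi : continuous psi.
Proof. by move=> t; apply: cvgV; [rewrite gt_eqF|exact: cmu]. Qed.

Let mpsi : measurable_fun setT psi.
Proof. exact: continuous_measurable_fun. Qed.

Let psi0 t : 0 <= psi t. Proof. by rewrite invr_ge0 ltW. Qed.

Let psi_le t : psi t <= mu0^-1. Proof. by rewrite lef_pV2 ?posrE. Qed.

Let HE t s : H t s = psi t + psi t * (lambda * gam)^-1 * (t - s) `^ (- alpha).
Proof. by rewrite /H /mode_kernel -mulrA invfM. Qed.

Let lg0 : 0 <= (lambda * gam)^-1.
Proof. by rewrite invr_ge0 mulr_ge0 ?ltW. Qed.

Let mH : measurable_fun [set: RR] (fun p : RR => H p.1 p.2).
Proof.
have m1 : measurable_fun [set: RR] (fun p : RR => p.1) by exact: measurable_fst.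
have m2 : measurable_fun [set: RR] (fun p : RR => p.2) by exact: measurable_snd.
have mp : measurable_fun [set: RR] (fun p : RR => psi p.1).
  exact: (measurableT_comp mpsi m1).
rewrite (_ : (fun p : RR => H p.1 p.2) = (fun p : RR =>
  psi p.1 + psi p.1 * (lambda * gam)^-1 * (p.1 - p.2) `^ (- alpha))); last first.
  by apply/funext => p; exact: HE.
apply: measurable_funD => //; apply: measurable_funM; first exact: measurable_funM.
by apply: (measurableT_comp (measurable_powR (- alpha))); exact: measurable_funB.
Qed.

Let H0 t s : 0 <= H t s.
Proof. by rewrite HE addr_ge0 ?mulr_ge0 ?powR_ge0. Qed.

Section horizon.
Variable T : R.
Hypothesis T0 : 0 < T.

Let C : R := mu0^-1 * T `^ alpha + mu0^-1 * (lambda * gam)^-1.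

Let HC t s : 0 <= s -> s < t -> t <= T -> H t s <= C * (t - s) `^ (- alpha).
Proof.
move=> s0 st tT; have /andP[a0 a1] := a01.
have ts0 : 0 < t - s by rewrite subr_gt0.
have mu0V : 0 <= mu0^-1 by rewrite invr_ge0 ltW.
rewrite HE mulrDl; apply: lerD.
  rewrite -mulrA -[leLHS]mulr1; apply: ler_pM => //.
  rewrite powRN -(@divff _ ((t - s) `^ alpha)) ?gt_eqF ?powR_gt0//.
  rewrite ler_wpM2r ?invr_ge0 ?powR_ge0//.
  apply: ge0_ler_powR; rewrite ?nnegrE ?(ltW a0) ?(ltW T0) ?(ltW ts0)//.
  by lra.
by rewrite ler_wpM2r ?powR_ge0// ler_wpM2r.
Qed.

Let mft (f : R -> R) t : t \in `[0, T] -> measurable_fun `[0, T] f ->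
  measurable_fun `[0, t] f.
Proof.
rewrite in_itv/= => /andP[t0 tT]; apply: measurable_funS => //.
by apply: subset_itvl; rewrite bnd_simp.
Qed.

Let volterra_opE (f : R -> R) (M : R) t : measurable_fun `[0, T] f ->
  (forall s, s \in `[0, T] -> `|f s| <= M) -> t \in `[0, T] ->
  [/\ leb.-integrable `[0, t] (EFin \o f),
      leb.-integrable `[0, t] (EFin \o (fun s => (t - s) `^ (- alpha) * f s)) &
  volterra_op H f t = psi t * (\int[leb]_(s in `[0, t]) f s) +
    psi t * (lambda * gam)^-1 * fractional_integral alpha f t].
Proof.
move=> mf fM tT; have /andP[t0 tT'] : 0 <= t <= T by move: tT; rewrite in_itv.
have /andP[a0 a1] := a01.
have mf' := mft tT mf.
have fM' s : s \in `[0, t] -> `|f s| <= M.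
  rewrite in_itv/= => /andP[s0 st]; apply: fM.
  by rewrite in_itv/= s0 (le_trans st).
have i1 : leb.-integrable `[0, t] (EFin \o f).
  have [] := @weakly_singular_integrableM _ 0 1 M t (cst 1) f ltr01 ler01 t0.
  - exact: measurable_cst.
  - by move=> s; exact: ler01.
  - by move=> s _ _; rewrite oppr0 powRr0 mulr1.
  - exact: mf'.
  - exact: fM'.
  by under [in X in integrable _ _ X]eq_fun do rewrite mul1r.
have i2 : leb.-integrable `[0, t] (EFin \o (fun s => (t - s) `^ (- alpha) * f s)).
  have [] := @weakly_singular_integrableM _ alpha 1 M t
    (fun s => (t - s) `^ (- alpha)) f a1 ler01 t0.
  - exact: measurable_powR_subl.
  - by move=> s; exact: powR_ge0.
  - by move=> s _ _; rewrite mul1r.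
  - exact: mf'.
  - exact: fM'.
  by [].
split=> //.
have mI : @measurable _ (measurableTypeR R) `[0, t] by exact: measurable_itv.
have E1 : psi t * (\int[leb]_(s in `[0, t]) f s) =
    \int[leb]_(s in `[0, t]) (psi t * f s) by rewrite RintegralZl.
have E2 : psi t * (lambda * gam)^-1 * fractional_integral alpha f t =
    \int[leb]_(s in `[0, t])
      (psi t * (lambda * gam)^-1 * ((t - s) `^ (- alpha) * f s)).
  by rewrite RintegralZl.
have j1 : leb.-integrable `[0, t] (EFin \o (fun s => psi t * f s)).
  by have := integrableZl mI (psi t) i1.
have j2 : leb.-integrable `[0, t] (EFin \o
    (fun s => psi t * (lambda * gam)^-1 * ((t - s) `^ (- alpha) * f s))).
  by have := integrableZl mI (psi t * (lambda * gam)^-1) i2.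
rewrite E1 E2 /volterra_op -RintegralD//.
by apply: eq_Rintegral => s _; rewrite HE; ring.
Qed.

Let HV (f : R -> R) (M : R) : measurable_fun `[0, T] f ->
  (forall s, s \in `[0, T] -> `|f s| <= M) ->
  {within `[0, T], continuous (volterra_op H f)}.
Proof.
move=> mf fM.
apply: (@subspace_eq_continuous _ _ _ (fun t => psi t * fractional_integral 0 f t +
    psi t * (lambda * gam)^-1 * fractional_integral alpha f t)).
  move=> t; rewrite inE/= => tT; have [_ _ E] := volterra_opE mf fM tT.
  apply: etrans (esym E); congr (_ * _ + _); apply: eq_Rintegral => s _.
  by rewrite oppr0 powRr0 mul1r.
have c0 := fractional_integral_continuous (g := 0) _ (ltW T0) mf fM.
have c1 := fractional_integral_continuous a01' (ltW T0) mf fM.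
have cp : {within `[0, T], continuous psi} by exact: continuous_subspaceT.
move=> x; apply: cvgD; apply: cvgM.
- exact: cp.
- by apply: c0; rewrite lexx ltr01.
- by apply: cvgM; [exact: cp|exact: cvg_cst].
- exact: c1.
Qed.

Lemma mode_derivative_continuous : {within `[0, T], continuous mode_derivative}.
Proof.
have h := resolvent_integral_continuous mH H0 T0 a01' HC HV mpsi psi0 psi_le.
move=> x; apply: cvgN; apply: cvgD; last exact: h.
by apply: continuous_subspaceT.
Qed.

(** The Volterra equation [Y = - psi - V Y], with [V] split into its two parts and
    multiplied by [mu t * lambda], is the mode equation. *)
Lemma mode_derivative_volterra t : t \in `[0, T] ->
  [/\ leb.-integrable `[0, t] (EFin \o mode_derivative),
      leb.-integrable `[0, t]
        (EFin \o (fun s => (t - s) `^ (- alpha) * mode_derivative s)) &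
  gam^-1 * (\int[leb]_(s in `[0, t]) ((t - s) `^ (- alpha) * mode_derivative s)) +
  mu t * lambda * mode_derivative t +
  lambda * (1 + \int[leb]_(s in `[0, t]) mode_derivative s) = 0].
Proof.
move=> tT; have /andP[t0 tT'] : 0 <= t <= T by move: tT; rewrite in_itv.
have mR := resolvent_integral_measurable mH H0 T0 a01' HC HV mpsi psi0 psi_le.
have [K RK] := resolvent_integral_bounded mH H0 T0 a01' HC mpsi psi0 psi_le.
have mp : measurable_fun `[0, T] psi by exact: measurable_funTS.
have pM s : s \in `[0, T] -> `|psi s| <= mu0^-1.
  by move=> _; rewrite ger0_norm.
have mY : measurable_fun `[0, T] mode_derivative.
  by apply: measurableT_comp => //; exact: measurable_funD.
have YM s : s \in `[0, T] -> `|mode_derivative s| <= mu0^-1 + K.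
  move=> sT; rewrite normrN; apply: le_trans (ler_normD _ _) _.
  by apply: lerD; [exact: pM|exact: RK].
have [i1 i2 VY] := volterra_opE mY YM tT.
split=> //.
have E : volterra_op H mode_derivative t = resolvent_integral H psi t.
  have [j1 _] := volterra_op_bound mH H0 T0 a01' HC t0 tT' mp pM.
  have [j2 _] := volterra_op_bound mH H0 T0 a01' HC t0 tT' mR RK.
  rewrite (resolvent_integral_eq mH H0 T0 a01' HC HV mpsi psi0 psi_le)//.
  have mI : @measurable _ (measurableTypeR R) `[0, t] by exact: measurable_itv.
  rewrite /volterra_op -RintegralD// -mulN1r -RintegralZl//.
    by apply: eq_Rintegral => s _; rewrite /mode_derivative; ring.
  by have := integrableD mI j1 j2.
have {E}E : mode_derivative t = - psi t - volterra_op H mode_derivative t.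
  by rewrite E /mode_derivative opprD.
rewrite VY in E; rewrite -/(fractional_integral alpha mode_derivative t).
move: E; set y := mode_derivative t; set F := fractional_integral _ _ _.
set I := \int[_]_(_ in _) _ => ->; rewrite /psi.
by field; rewrite !gt_eqF.
Qed.
End horizon.
End mode_volterra.

(** * Derivatives relative to an interval *)

Section one_sided_derivatives.
Context {R : realType}.
Implicit Types (f : R -> R) (a b x l : R) (D : set R).

Definition diff_quotient f x y : R := (f y - f x) / (y - x).

Lemma is_derive1_diff_quotient f x l :
  is_derive x 1 f l <-> diff_quotient f x y @[y --> x^'] --> l.
Proof.
split=> [/is_derive1_caratheodory [g [hg cg gx]]|h].
  have /continuous_withinNx := cg; rewrite gx; apply: cvg_trans.
  apply: near_eq_cvg; near=> y; rewrite /diff_quotient hg mulfK// subr_eq0.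
  by near: y; exact: nbhs_dnbhs_neq.
apply/is_derive1_caratheodory.
exists (fun y => if y == x then l else diff_quotient f x y); split.
- move=> z; case: eqVneq => [->|zx]; first by rewrite !subrr mulr0.
  by rewrite /diff_quotient mulfVK// subr_eq0.
- apply/continuous_withinNx; rewrite eqxx; apply: cvg_trans h.
  apply: near_eq_cvg; near=> y; rewrite ifF//; apply/negbTE.
  by near: y; exact: nbhs_dnbhs_neq.
- by rewrite eqxx.
Unshelve. all: by end_near. Qed.

Lemma within_dnbhs_mono (D D' : set R) x (q : R -> R) l :
  (\forall y \near x, y != x -> D y -> D' y) ->
  q y @[y --> within D' x^'] --> l -> q y @[y --> within D x^'] --> l.
Proof.
move=> DD' qD'; apply: cvg_trans qD' => P hP.
change (nbhs x (fun y => y != x -> D' y -> P (q y))) in hP.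
change (nbhs x (fun y => y != x -> D y -> P (q y))).
by apply: filterS2 DD' hP => y h1 h2 yx Dy; exact: h2 yx (h1 yx Dy).
Qed.

Lemma cvg_within_at_left a b x (q : R -> R) l : a < x -> x <= b ->
  q y @[y --> within `[a, b] x^'] --> l -> q y @[y --> x^'-] --> l.
Proof.
move=> ax xb; apply: cvg_trans => P hP.
change (nbhs x (fun y => y != x -> y \in `[a, b] -> P (q y))) in hP.
change (nbhs x (fun y => y < x -> P (q y))).
apply: filterS2 (lt_nbhsr ax) hP => y ay h yx; apply: h.
  by rewrite lt_eqF.
by rewrite in_itv/= (ltW ay) (le_trans (ltW yx) xb).
Qed.

Lemma cvg_within_dnbhs_interior a b x (q : R -> R) l : a < x -> x < b ->
  q y @[y --> within `[a, b] x^'] --> l -> q y @[y --> x^'] --> l.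
Proof.
move=> ax xb; apply: cvg_trans => P hP.
change (nbhs x (fun y => y != x -> y \in `[a, b] -> P (q y))) in hP.
change (nbhs x (fun y => y != x -> P (q y))).
apply: filterS3 (lt_nbhsr ax) (lt_nbhsl xb) hP => y ay yb h yx; apply: h => //.
by rewrite in_itv/= (ltW ay) (ltW yb).
Qed.

(** Properness makes the limit in [derive_in] unique; it holds because a
    nondegenerate interval accumulates at each of its points, from at least one
    side. *)
Lemma within_dnbhs_itv_proper a b x : a < b -> x \in `[a, b] ->
  ProperFilter (within `[a, b] x^').
Proof.
move=> ab; rewrite in_itv/= => /andP[ax xb].
apply: Build_ProperFilter_ex => P hP.
change (nbhs x (fun y => y != x -> y \in `[a, b] -> P y)) in hP.
have [xb'|bx] := ltP x b.
  have /filter_ex [y [[yx yb] hy]] : \forall y \near x^'+, (x < y /\ y < b) /\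
      (y != x -> y \in `[a, b] -> P y).
    apply: filterI; last by apply: filterS hP => y h _.
    by apply: filterI; [exact: nbhs_right_gt|exact: nbhs_right_lt].
  exists y; apply: hy; first by rewrite gt_eqF.
  by rewrite in_itv/= (ltW yb) (le_trans ax (ltW yx)).
have xbE : x = b by apply/eqP; rewrite eq_le xb.
have ax' : a < x by rewrite xbE.
have /filter_ex [y [[yx ya] hy]] : \forall y \near x^'-, (y < x /\ a < y) /\
    (y != x -> y \in `[a, b] -> P y).
  apply: filterI; last by apply: filterS hP => y h _.
  by apply: filterI; [exact: nbhs_left_lt|exact: nbhs_left_gt].
exists y; apply: hy; first by rewrite lt_eqF.
by rewrite in_itv/= (ltW ya) (le_trans (ltW yx) xb).
Qed.

Lemma derive_in_itvE a b f x l : a < b -> x \in `[a, b] ->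
  diff_quotient f x y @[y --> within `[a, b] x^'] --> l ->
  derivable_in `[a, b] f x /\ derive_in `[a, b] f x = l.
Proof.
move=> ab xab h; have PF := within_dnbhs_itv_proper ab xab; split.
  by apply/cvg_ex; exists l; exact: h.
exact: (cvg_lim (@Rhausdorff R) h).
Qed.

Lemma derive_in_itv_cvg a b f x : derivable_in `[a, b] f x ->
  diff_quotient f x y @[y --> within `[a, b] x^'] --> derive_in `[a, b] f x.
Proof. by []. Qed.

Lemma derive_in_itv_eq a b f g x l : a < b -> x \in `[a, b] ->
  is_derive x 1 g l -> (forall y, y \in `[a, b] -> f y = g y) ->
  derivable_in `[a, b] f x /\ derive_in `[a, b] f x = l.
Proof.
move=> ab xab /is_derive1_diff_quotient h fg; apply: derive_in_itvE => //.
apply: cvg_trans h => P hP.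
change (nbhs x (fun y => y != x -> P (diff_quotient g x y))) in hP.
change (nbhs x (fun y => y != x -> y \in `[a, b] -> P (diff_quotient f x y))).
apply: filterS hP => y h1 yx yab.
by rewrite /diff_quotient !fg//; exact: h1.
Qed.
End one_sided_derivatives.

(** * Mode solutions *)

Lemma abs_cont_on_continuous {R : realType} (T : R) (f : R -> R) : 0 <= T ->
  abs_cont_on 0 T f -> {within `[0, T], continuous f}.
Proof.
move=> T0 hf; apply: uniform_within_continuous => // e e0.
have [d d0 hd] := hf e e0; exists d => // x y x0 xy yT xyd.
have := hd 1%N (fun=> x) (fun=> y); rewrite !big_ord1; apply => //.
by move=> i j _ _ _; rewrite (ord1 i) (ord1 j).
Qed.

Lemma lipschitz_abs_cont_on {R : realType} (a b K : R) (f : R -> R) : 0 <= K ->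
  (forall x y, a <= x -> x <= y -> y <= b -> `|f y - f x| <= K * (y - x)) ->
  abs_cont_on a b f.
Proof.
move=> K0 hf e e0; have K1 : 0 < K + 1 by lra.
exists (e / (K + 1)); first by rewrite divr_gt0.
move=> n u v huv _ hs.
apply: (@le_lt_trans _ _ (\sum_(i < n) (K * (v i - u i)))).
  by apply: ler_sum => i _; have [h1 h2 h3] := huv i; exact: hf.
rewrite -mulr_sumr; have sum0 : 0 <= \sum_(i < n) (v i - u i).
  by apply: sumr_ge0 => i _; rewrite subr_ge0; have [] := huv i.
apply: (@le_lt_trans _ _ ((K + 1) * \sum_(i < n) (v i - u i))).
  by rewrite ler_wpM2r//; lra.
by rewrite -ltr_pdivlMl// mulrC.
Qed.

(** The derivative of a solution is only controlled inside the interval, while the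
    Caputo integral runs over the closed one. *)
Lemma eq_itvoo_integrable {R : realType} (a b : R) (f g : R -> R) :
  {in `]a, b[, f =1 g} -> leb.-integrable `[a, b] (EFin \o f) ->
  leb.-integrable `[a, b] (EFin \o g) /\
  \int[leb]_(x in `[a, b]) f x = \int[leb]_(x in `[a, b]) g x.
Proof.
move=> fg fi.
have sub : `]a, b[ `<=` `[a, b] by exact: subset_itv_oo_cc.
have fio : leb.-integrable `]a, b[ (EFin \o f).
  by apply: (@integrableS _ _ _ leb `[a, b]).
have gio : leb.-integrable `]a, b[ (EFin \o g).
  apply: eq_integrable fio => // x; rewrite inE/= => xab.
  by rewrite /= fg.
have mg : measurable_fun `[a, b] (EFin \o g).
  by apply: (@emeasurable_fun_itv_cc _ _ _ false true); exact: measurable_int gio.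
split.
  apply/integrableP; split; first exact: mg.
  have /integrableP[_] := gio.
  rewrite -[X in (X < _)%E -> _](@integral_itv_bndoo _ a b _ true false)//.
  by apply: measurableT_comp => //; exact: measurable_int gio.
rewrite /Rintegral (@eq_integral_itv_bounded _ a b g f)//.
- by apply/measurable_EFinP; exact: measurable_int fio.
- by apply/measurable_EFinP; exact: measurable_int gio.
Qed.

Section interior_regularity.
Context {R : realType}.
Variables (a b : R) (f : R -> R).
Hypothesis f1 : C1_on a b f.

Lemma C1_on_is_derive t : t \in `]a, b[ ->
  is_derive t 1 f (derive_in `[a, b] f t).
Proof.
move=> tab; have /andP[at' tb] : a < t < b by move: tab; rewrite in_itv.
apply/is_derive1_diff_quotient; apply: (cvg_within_dnbhs_interior at' tb).
apply: derive_in_itv_cvg; apply: f1.1.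
exact: subset_itv_oo_cc.
Qed.

Lemma C1_on_derive1 t : t \in `]a, b[ -> derive1 f t = derive_in `[a, b] f t.
Proof. by move=> /C1_on_is_derive h; rewrite derive1E; case: h. Qed.

Lemma C1_on_derive1_continuous t : t \in `]a, b[ -> {for t, continuous (derive1 f)}.
Proof.
move=> tab; have /andP[at' tb] : a < t < b by move: tab; rewrite in_itv.
have [h _ _] := (continuous_within_itvP _ (lt_trans at' tb)).1 f1.2.
have := h t tab; rewrite /prop_for /continuous_at -C1_on_derive1//; apply: cvg_trans.
apply: near_eq_cvg; near=> s; rewrite C1_on_derive1// in_itv/=.
by apply/andP; split; near: s; [exact: lt_nbhsr|exact: lt_nbhsl].
Unshelve. all: by end_near. Qed.
End interior_regularity.

(** C^1 regularity between [t / 2] and [T] gives both the two-sided derivative inside and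
    the left derivative at [T], the latter being insensitive to the left end of
    the interval on which the derivative is taken. *)
Lemma mode_solution_data {R : realType} (alpha T lambda : R) (mu w : R -> R) :
  0 < T -> mode_solution alpha T mu lambda w ->
  mode_data alpha (Gamma (1 - alpha))^-1 T (fun t => mu t * lambda) lambda w
    (derive1 w) (derive_in `[0, T] w).
Proof.
move=> T0 [acw c1w eqw w0].
have half t : 0 < t -> t <= T -> (t / 2 \in `]0, T[) /\ t / 2 < t.
  by move=> t0 tT; rewrite in_itv/=; split; lra.
have int_ t : t \in `]0, T[ -> exists2 d, C1_on d T w & t \in `]d, T[.
  rewrite in_itv/= => /andP[t0 tT]; have [h1 h2] := half t t0 (ltW tT).
  by exists (t / 2); [exact: c1w|rewrite in_itv/= h2].
split.
- exact: abs_cont_on_continuous (ltW T0) acw.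
- move=> t /int_ [d c1 td]; rewrite (C1_on_derive1 c1 td).
  exact: C1_on_is_derive.
- by move=> t /int_ [d c1 td]; exact: C1_on_derive1_continuous c1 _ td.
- move=> t; rewrite in_itv/= => /andP[t0 tT]; have [h1 h2] := half t t0 tT.
  have [dw _] := c1w _ h1.
  have tdT : t \in `[t / 2, T] by rewrite in_itv/= (ltW h2).
  have h := derive_in_itv_cvg (dw _ tdT).
  have [_ ->] : derivable_in `[0, T] w t /\
      derive_in `[0, T] w t = derive_in `[t / 2, T] w t.
    apply: derive_in_itvE => //; first by rewrite in_itv/= (ltW t0).
    apply: within_dnbhs_mono h.
    apply: filterS (lt_nbhsr h2) => y hy _ /=; rewrite !in_itv/= => /andP[_ ->].
    by rewrite (ltW hy).
  exact: (cvg_within_at_left h2 tT h).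
- by move=> t /eqw[].
- by move=> t /eqw[].
Qed.

Lemma mode_solution_unique {R : realType} (alpha T lambda : R) (mu w1 w2 : R -> R) :
  0 < alpha < 1 -> 0 < T -> 0 < lambda ->
  (forall t, t \in `[0, T] -> 0 < mu t) ->
  mode_solution alpha T mu lambda w1 -> mode_solution alpha T mu lambda w2 ->
  forall t, t \in `[0, T] -> w1 t = w2 t.
Proof.
move=> a01 T0 l0 mu0 s1 s2 t tT.
have c0 : 0 < (Gamma (1 - alpha))^-1 by rewrite invr_gt0 Gamma_gt0.
have m0 s : s \in `[0, T] -> 0 < mu s * lambda by move=> /mu0 h; rewrite mulr_gt0.
have d1 := mode_solution_data T0 s1; have d2 := mode_solution_data T0 s2.
have [_ _ _ w10] := s1; have [_ _ _ w20] := s2.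
have e1 : 0 <= w1 0 - w2 0 by rewrite w10 w20 subrr.
have e2 : 0 <= w2 0 - w1 0 by rewrite w10 w20 subrr.
have [h1 _] := mode_data_comparison a01 c0 T0 l0 m0 (mode_dataB d1 d2) e1 tT.
have [h2 _] := mode_data_comparison a01 c0 T0 l0 m0 (mode_dataB d2 d1) e2 tT.
by apply/eqP; rewrite eq_le -(subr_ge0 (w2 t)) -(subr_ge0 (w1 t)) h1 h2.
Qed.

Lemma mode_solution_gt0 {R : realType} (alpha T lambda : R) (mu w : R -> R) :
  0 < alpha < 1 -> 0 < T -> 0 < lambda ->
  (forall t, t \in `[0, T] -> 0 < mu t) ->
  mode_solution alpha T mu lambda w -> forall t, t \in `[0, T] -> 0 < w t.
Proof.
move=> a01 T0 l0 mu0 s1 t tT.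
have c0 : 0 < (Gamma (1 - alpha))^-1 by rewrite invr_gt0 Gamma_gt0.
have m0 s : s \in `[0, T] -> 0 < mu s * lambda by move=> /mu0 h; rewrite mulr_gt0.
have [_ _ _ w0] := s1.
have w00 : 0 <= w 0 by rewrite w0.
have [_] := mode_data_comparison a01 c0 T0 l0 m0 (mode_solution_data T0 s1) w00 tT.
by apply; rewrite w0.
Qed.

Section solution_from_derivative.
Context {R : realType}.
Variables (alpha T T' lambda : R) (mu Y w : R -> R).
Hypothesis T0 : 0 < T.
Hypothesis TT' : T < T'.
Hypothesis cmu : {within `[0, T], continuous mu}.
Hypothesis cY : {within `[0, T'], continuous Y}.
Hypothesis iY : forall t, t \in `[0, T'] ->
  leb.-integrable `[0, t] (EFin \o (fun s => (t - s) `^ (- alpha) * Y s)).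
Hypothesis wE : forall t, t \in `[0, T] -> w t = 1 + \int[leb]_(s in `[0, t]) Y s.
Hypothesis eqY : forall t, t \in `[0, T] ->
  (Gamma (1 - alpha))^-1 * (\int[leb]_(s in `[0, t]) ((t - s) `^ (- alpha) * Y s)) +
  mu t * lambda * Y t + lambda * (1 + \int[leb]_(s in `[0, t]) Y s) = 0.

Let W (t : R) : R := 1 + \int[leb]_(s in `[0, t]) Y s.

Let T'0 : 0 < T'. Proof. exact: lt_trans TT'. Qed.

Let intY : leb.-integrable `[0, T'] (EFin \o Y).
Proof. by apply: continuous_compact_integrable => //; exact: segment_compact. Qed.

Let dW t : 0 < t -> t < T' -> is_derive t 1 W (Y t).
Proof.
move=> t0 tT'; have tI : t \in `]0, T'[ by rewrite in_itv/= t0.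
have [cY' _ _] := (continuous_within_itvP _ T'0).1 cY.
have [h1 h2] := continuous_FTC1_closed tT' intY t0 (cY' t tI).
have h : is_derive t 1 (fun t => \int[leb]_(s in `[0, t]) Y s) (Y t).
  by split; [exact: h1|rewrite -derive1E].
by apply: is_derive_eq (is_deriveD (is_derive_cst (1 : R) _ _) h) _; rewrite add0r.
Qed.

Let cW : {within `[0, T'], continuous W}.
Proof.
move=> x; apply: cvgD; first exact: cvg_cst.
exact: (parameterized_integral_continuous (ltW T'0) intY).
Qed.

Let subT a : 0 <= a -> `[a, T] `<=` `[0, T].
Proof. by move=> a0; apply: subset_itvr; rewrite bnd_simp. Qed.

Let derive_inE a t : 0 <= a -> a < T -> 0 < t -> t \in `[a, T] ->
  derivable_in `[a, T] w t /\ derive_in `[a, T] w t = Y t.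
Proof.
move=> a0 aT t0 taT.
have tT' : t < T' by move: taT; rewrite in_itv/= => /andP[_ /le_lt_trans]; exact.
apply: (derive_in_itv_eq aT taT (dW t0 tT')) => y yaT.
by rewrite wE//; exact: subT yaT.
Qed.

Let derive1E' t : t \in `]0, T[ -> derive1 w t = Y t.
Proof.
rewrite in_itv/= => /andP[t0 tT].
have h : is_derive t 1 w (Y t).
  apply: near_eq_is_derive (dW t0 (lt_trans tT TT')).
  near=> s; rewrite wE// in_itv/=; apply/andP; split; apply: ltW; near: s.
    exact: lt_nbhsr.
  exact: lt_nbhsl.
by rewrite derive1E; case: h.
Unshelve. all: by end_near. Qed.

Let caputoE t : t \in `]0, T] -> caputo_ex alpha w t /\
  caputo alpha w t =
  (Gamma (1 - alpha))^-1 * (\int[leb]_(s in `[0, t]) ((t - s) `^ (- alpha) * Y s)).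
Proof.
rewrite in_itv/= => /andP[t0 tT].
have tI : t \in `[0, T'] by rewrite in_itv/= (ltW t0) (le_trans tT (ltW TT')).
have E : {in `]0, t[, (fun s => (t - s) `^ (- alpha) * Y s) =1
    (fun s => (t - s) `^ (- alpha) * derive1 w s)}.
  move=> s; rewrite in_itv/= => /andP[s0 st]; rewrite derive1E'//.
  by rewrite in_itv/= s0 (lt_le_trans st).
have [h1 h2] := eq_itvoo_integrable E (iY tI).
by split; [exact: h1|rewrite /caputo h2].
Qed.

Lemma solution_C1_on a : a \in `]0, T[ -> C1_on a T w.
Proof.
rewrite in_itv/= => /andP[a0 aT].
have pos x : x \in `[a, T] -> 0 < x.
  by rewrite in_itv/= => /andP[/(lt_le_trans a0)].
split=> [x xaT|].
  by have [] := derive_inE (ltW a0) aT (pos x xaT) xaT.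
apply: (@subspace_eq_continuous _ _ _ Y).
  move=> x; rewrite inE/= => xaT.
  by have [_ E] := derive_inE (ltW a0) aT (pos x xaT) xaT; exact: esym E.
apply: continuous_subspaceW cY => x /subT; move=> /(_ (ltW a0)).
by rewrite /= !in_itv/= => /andP[-> /le_trans]; apply; exact: ltW.
Qed.

Lemma solution_equation t : t \in `]0, T] ->
  caputo_ex alpha w t /\ mode_equation_at alpha T mu lambda w t.
Proof.
move=> tT; have /andP[t0 tT2] : 0 < t <= T by move: tT; rewrite in_itv.
have tT3 : t \in `[0, T] by rewrite in_itv/= (ltW t0).
have [h1 h2] := caputoE tT; split=> //.
have [_ h3] := derive_inE (lexx 0) T0 t0 tT3.
by rewrite /mode_equation_at h2 h3 wE// eqY.
Qed.

Lemma solution_abs_cont : abs_cont_on 0 T w.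
Proof.
have subTT' : `[0, T] `<=` `[0, T'].
  by apply: subset_itvl; rewrite bnd_simp; exact: ltW.
have cn : {within `[0, T], continuous (fun x => `|Y x|)}.
  by move=> x; apply: cvg_norm; exact: (continuous_subspaceW subTT' cY).
have [c _ hc] := EVT_max (ltW T0) cn.
apply: (@lipschitz_abs_cont_on _ 0 T `|Y c|) => // x y x0 xy yT.
have inT z : x <= z -> z <= y -> z \in `[0, T].
  by move=> xz zy; rewrite in_itv/= (le_trans x0 xz) (le_trans zy).
rewrite !wE ?inT// -!/(W _).
have [| |z zxy ->] := @MVT_segment _ W Y x y xy.
- move=> z; rewrite in_itv/= => /andP[xz zy]; apply: dW.
    exact: le_lt_trans xz.
  exact: lt_trans zy (le_lt_trans yT TT').
- apply: continuous_subspaceW cW => z /=; rewrite !in_itv/= => /andP[xz zy].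
  by rewrite (le_trans x0 xz) (le_trans zy)// (le_trans yT)// ltW.
rewrite normrM [`|y - x|]ger0_norm ?subr_ge0// ler_wpM2r ?subr_ge0// hc//.
by move: zxy; rewrite in_itv/= => /andP[xz zy]; exact: inT.
Qed.

Lemma solution_mode : mode_solution alpha T mu lambda w.
Proof.
split; [exact: solution_abs_cont|exact: solution_C1_on|exact: solution_equation|].
by rewrite wE ?in_itv/= ?lexx ?(ltW T0)// set_itv1 Rintegral_set1 addr0.
Qed.

Lemma solution_caputo_continuous a : a \in `]0, T[ ->
  {within `[a, T], continuous (caputo alpha w)}.
Proof.
rewrite in_itv/= => /andP[a0 aT].
apply: (@subspace_eq_continuous _ _ _ (fun t => - (mu t * lambda * Y t + lambda * W t))).
  move=> t; rewrite inE/= in_itv/= => /andP[at' tT].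
  have t0 : 0 < t := lt_le_trans a0 at'.
  have t1 : t \in `]0, T] by rewrite in_itv/= t0.
  have t2 : t \in `[0, T] by rewrite in_itv/= (ltW t0).
  have [_ E] := caputoE t1; apply: etrans (esym E).
  by have := eqY t2; rewrite -/(W t); lra.
have sub : `[a, T] `<=` `[0, T'].
  move=> x /=; rewrite !in_itv/= => /andP[ax xT].
  by rewrite (le_trans (ltW a0) ax) (le_trans xT (ltW TT')).
have c1 : {within `[a, T], continuous mu}.
  by apply: continuous_subspaceW cmu; exact: subT (ltW a0).
have c2 : {within `[a, T], continuous Y} by exact: continuous_subspaceW sub cY.
have c3 : {within `[a, T], continuous W} by exact: continuous_subspaceW sub cW.
move=> x; apply: cvgN; apply: cvgD; apply: cvgM.
- by apply: cvgM; [exact: c1|exact: cvg_cst].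
- exact: c2.
- exact: cvg_cst.
- exact: c3.
Qed.
End solution_from_derivative.

(** * The resolvent formula solves the mode problem *)

Lemma eq_iterated_kernel {R : realType} (H H' : R -> R -> R) (a b : R) n t s :
  (forall t s, t \in `[a, b] -> H t s = H' t s) ->
  t \in `[a, b] -> a <= s ->
  iterated_kernel H n t s = iterated_kernel H' n t s.
Proof.
move=> HH; elim: n t s => [|n IH] t s tab sa /=; first exact: HH.
have /andP[_ tb] : a <= t <= b by move: tab; rewrite in_itv.
apply: eq_Rintegral => z; rewrite inE/= in_itv/= => /andP[sz zt].
by rewrite HH// IH// in_itv/= (le_trans sa sz) (le_trans zt tb).
Qed.

(** Only the values of [mu] on [0, T] enter the resolvent formula there, so that
    [mu] may be replaced by an extension that is continuous on the line. *)
Lemma eq_mode_A {R : realType} (alpha l T : R) (mu mu' : R -> R) k t :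
  (forall s, s \in `[0, T] -> mu s = mu' s) -> t \in `[0, T] ->
  mode_A alpha l mu k t = mode_A alpha l mu' k t.
Proof.
move=> mm tT; have /andP[_ tT'] : 0 <= t <= T by move: tT; rewrite in_itv.
rewrite /mode_A; congr (_ - _ - _); apply: eq_Rintegral => x;
  rewrite inE/= in_itv/= => /andP[x0 xt].
  by rewrite mm// in_itv/= x0 (le_trans xt).
have xT : x \in `[0, T] by rewrite in_itv/= x0 (le_trans xt).
apply: eq_Rintegral => s; rewrite inE/= in_itv/= => /andP[s0 sx].
have /andP[_ xT'] : 0 <= x <= T by move: xT; rewrite in_itv.
rewrite mm ?in_itv/= ?s0 ?(le_trans sx)//; congr (_ * _).
rewrite /resolvent_kernel; congr (limn (series _)); apply/funext => n.
congr (_ * _); apply: (@eq_iterated_kernel _ _ _ 0 T) => // u v uT.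
by rewrite /mode_kernel mm.
Qed.

Lemma mode_lambda_gt0 {R : realType} (l : R) k : 0 < l -> (1 <= k)%N ->
  0 < mode_lambda l k.
Proof.
move=> l0 k1; rewrite /mode_lambda exprn_gt0// divr_gt0// mulr_gt0 ?pi_gt0//.
by rewrite ltr0n.
Qed.

Lemma mode_A_derivative {R : realType} (alpha l mu0 T : R) (mu : R -> R) k t :
  0 < alpha < 1 -> 0 < l -> (1 <= k)%N -> 0 < mu0 -> continuous mu ->
  (forall t, mu0 <= mu t) -> 0 < T -> t \in `[0, T] ->
  mode_A alpha l mu k t =
    1 + \int[leb]_(s in `[0, t]) mode_derivative alpha (mode_lambda l k) mu s.
Proof.
move=> a01 l0 k1 mu00 cmu mu_ge T0 tT.
have lam0 := mode_lambda_gt0 l0 k1.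
have [i1 _ _] := mode_derivative_volterra a01 lam0 mu00 cmu mu_ge T0 tT.
have mI : @measurable _ (measurableTypeR R) `[0, t] by exact: measurable_itv.
have cV : continuous (fun s => (mu s)^-1).
  by move=> x; apply: cvgV; [rewrite gt_eqF// (lt_le_trans mu00)|exact: cmu].
have i2 : leb.-integrable `[0, t] (EFin \o (fun s => (mu s)^-1)).
  apply: continuous_compact_integrable; first exact: segment_compact.
  exact: continuous_subspaceT.
pose S := resolvent_integral (mode_kernel alpha mu (mode_lambda l k)) (fun s => (mu s)^-1).
have i3 : leb.-integrable `[0, t] (EFin \o S).
  have := integrableN (integrableD mI i1 i2).
  apply: eq_integrable => // s _.
  by rewrite /= /mode_derivative; congr EFin; rewrite opprD opprK addrAC subrr add0r.
have -> : \int[leb]_(s in `[0, t]) mode_derivative alpha (mode_lambda l k) mu s =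
    - (\int[leb]_(s in `[0, t]) (mu s)^-1 + \int[leb]_(s in `[0, t]) S s).
  rewrite -RintegralD// -mulN1r -RintegralZl//.
    by apply: eq_Rintegral => s _; rewrite mulN1r.
  by have := integrableD mI i2 i3.
by rewrite /mode_A opprD addrA.
Qed.

Theorem lemma2p5 (R : realType) (l T alpha mu0 : R) (mu : R -> R)
    (hl : 0 < l) (hT : 0 < T) (halpha : alpha \in `]0, 1[)
    (mu_cont : {within `[0, T], continuous mu})
    (hmu0 : 0 < mu0) (mu_ge : forall t, t \in `[0, T] -> mu0 <= mu t)
    (k : nat) (hk : (1 <= k)%N) :
  let A := mode_A alpha l mu k in
  let lambda := mode_lambda l k in
  (* the two descriptions of A on [0, T] are equivalent *)
  (forall w : R -> R, mode_solution alpha T mu lambda w <->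
     (forall t, t \in `[0, T] -> w t = A t)) /\
  (* (i) *)
  (abs_cont_on 0 T A /\
   (forall delta, delta \in `]0, T[ ->
      [/\ C1_on delta T A,
          forall t, t \in `[delta, T] -> caputo_ex alpha A t,
          {within `[delta, T], continuous (caputo alpha A)}
        & forall t, t \in `[delta, T] ->
            mode_equation_at alpha T mu lambda A t])) /\
  (* (ii) *)
  ((forall t, t \in `[0, T] -> 0 < A t) /\ 0 < A T).
Proof.
move=> A lambda.
have a01 : 0 < alpha < 1 by move: halpha; rewrite in_itv.
have lam0 : 0 < lambda := mode_lambda_gt0 hl hk.
(* A continuous extension of mu to the line, with the same lower bound, makes
   the kernel measurable everywhere. *)
pose nu := mu \o clamp T.
have nuE t : t \in `[0, T] -> mu t = nu t by move=> tT; rewrite /nu /= clamp_id.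
have cnu : continuous nu := continuous_comp_clamp (ltW hT) mu_cont.
have nu_ge t : mu0 <= nu t by apply: mu_ge; exact: clamp_itv (ltW hT) t.
have mu_gt0 t : t \in `[0, T] -> 0 < mu t by move=> /mu_ge; exact: lt_le_trans.
pose Y := mode_derivative alpha lambda nu.
(* Solving beyond T makes T an interior point, where the fundamental theorem
   of calculus gives a two-sided derivative. *)
have T1 : 0 < T + 1 by rewrite addr_gt0.
have TT1 : T < T + 1 by rewrite ltrDl.
have sub t : t \in `[0, T] -> t \in `[0, T + 1].
  by rewrite !in_itv/= => /andP[-> /le_trans]; apply; exact: ltW.
have cY : {within `[0, T + 1], continuous Y}.
  exact: (mode_derivative_continuous a01 lam0 hmu0 cnu nu_ge T1).
have vY t : t \in `[0, T + 1] -> _ :=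
  mode_derivative_volterra a01 lam0 hmu0 cnu nu_ge T1 (t := t).
have iY t : t \in `[0, T + 1] ->
    leb.-integrable `[0, t] (EFin \o (fun s => (t - s) `^ (- alpha) * Y s)).
  by move=> /vY[].
have eqY t : t \in `[0, T] ->
    (Gamma (1 - alpha))^-1 * (\int[leb]_(s in `[0, t]) ((t - s) `^ (- alpha) * Y s)) +
    mu t * lambda * Y t + lambda * (1 + \int[leb]_(s in `[0, t]) Y s) = 0.
  by move=> tT; rewrite (nuE _ tT); have [_ _] := vY _ (sub _ tT).
have AE t : t \in `[0, T] -> A t = 1 + \int[leb]_(s in `[0, t]) Y s.
  move=> tT; rewrite /A (eq_mode_A _ _ _ nuE tT).
  exact: mode_A_derivative a01 hl hk hmu0 cnu nu_ge T1 (sub _ tT).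
have solA : mode_solution alpha T mu lambda A.
  exact: (solution_mode hT TT1 cY iY AE eqY).
have pos := mode_solution_gt0 a01 hT lam0 mu_gt0 solA.
split; [move=> w; split|split; [split|split]].
- by move=> solw t tT; exact: mode_solution_unique solw solA t tT.
- move=> wA; apply: (solution_mode hT TT1 cY iY _ eqY) => t tT.
  by rewrite wA// AE.
- exact: (solution_abs_cont hT TT1 cY AE).
- move=> d dT; have [_ c1 eqA _] := solA.
  have pT t : t \in `[d, T] -> t \in `]0, T].
    move: dT; rewrite !in_itv/= => /andP[d0 _] /andP[dt ->].
    by rewrite (lt_le_trans d0).
  split.
  + exact: c1.
  + by move=> t /pT/eqA[].
  + exact: (solution_caputo_continuous hT TT1 mu_cont cY iY AE eqY).
  + by move=> t /pT/eqA[].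
- exact: pos.
- by apply: pos; rewrite in_itv/= lexx (ltW hT).
Qed.
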